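(* Let $N\ge 1$ be an integer, let $0<\lambda_0<\lambda_1<\dots<\lambda_N$, and let $A_0(0),\dots,A_N(0)$ be nonzero real numbers with $\sum_{j=0}^N A_j(0)=1$ such that $$p(x,0)=\sum_{j=0}^N A_j(0)\,\lambda_j e^{-\lambda_j x},\qquad x>0,$$ is a probability density on $(0,\infty)$ (that is, it is nonnegative). Let $p(x,\tau)$, $\tau\ge 0$, be the solution with this initial condition of $$\frac{\partial p(x,\tau)}{\partial \tau}=-p(x,\tau)+2\int_0^\infty p(y,\tau)\,p(x+y,\tau)\,dy .$$ Then for all $\tau\ge0$ the solution remains a sum of exponentials $$p(x,\tau)=\sum_{j=0}^N A_j(\tau)\,\lambda_j e^{-\lambda_j x},\qquad \sum_{j=0}^N A_j(\tau)=1,$$ whose coefficients satisfy, for $0\le k\le N$, $$\frac{dA_k}{d\tau}=A_k\sum_{j=0}^N A_j\,\frac{\lambda_j-\lambda_k}{\lambda_j+\lambda_k}.$$ Moreover, for every $1\le k\le N$, $$A_k(\tau)\sim\exp\left[-\frac{\lambda_k-\lambda_0}{\lambda_k+\lambda_0}\,\tau\right]\qquad(\tau\to\infty).$$ Consequently $p(x,\tau)\to\lambda_0e^{-\lambda_0x}$ as $\tau\to\infty$, and the mean $\mathbb{E}[x]=\int_0^\infty x\,p(x,\tau)\,dx$ satisfies $$\mathbb{E}[x]-\lambda_0^{-1}\sim\exp\left[-\frac{\lambda_1-\lambda_0}{\lambda_1+\lambda_0}\,\tau\right]\sim t^{-\frac{\lambda_1-\lambda_0}{\lambda_1+\lambda_0}},$$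 where $\tau=\ln(1+t)$ and $t\to\infty$.
   Context: The notation $f\sim g$ means that $f/g$ converges to a finite nonzero real constant (possibly negative) in the limit considered. A solution of the evolution equation is understood as a continuously differentiable curve $\tau\mapsto p(\cdot,\tau)$ in $L^1(0,\infty)$, defined for $\tau\ge 0$, with values in probability densities. The limit $p(x,\tau)\to\lambda_0e^{-\lambda_0x}$ is for each $x>0$. The variable $t\ge 0$ is the original time of the process and $\tau=\ln(1+t)$ is the rescaled time. *)

(* Defs.v *)
From HB Require Import structures.
From mathcomp Require Import all_boot all_order all_algebra.
From mathcomp Require Import all_classical all_reals all_analysis.

Set Implicit Arguments.
Unset Strict Implicit.
Unset Printing Implicit Defensive.

Import Order.TTheory GRing.Theory Num.Theory.
Import numFieldNormedType.Exports.

Local Open Scope classical_set_scope.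
Local Open Scope ring_scope.

Section Defs.
Context {R : realType}.
Implicit Types (f g : R -> R) (p dp : R -> R -> R).

Notation mu := (@lebesgue_measure R).
Notation Rpos := (`]0, +oo[%classic : set R).

(* Elements of L^1(0,oo) are represented by functions R -> R, whose values
   outside (0,oo) are irrelevant and which are identified when they agree
   almost everywhere on (0,oo). *)
Definition inL1 f : Prop := mu.-integrable Rpos (EFin \o f).

Definition L1norm f : R := \int[mu]_(x in Rpos) `|f x|.

Definition eqL1 f g : Prop := {ae mu, forall x : R, 0 < x -> f x = g x}.

Definition prob_density f : Prop :=
  [/\ inL1 f,
      {ae mu, forall x : R, 0 < x -> 0 <= f x} &
      \int[mu]_(x in Rpos) f x = 1].

Definition evolution_rhs f (x : R) : R :=
  - f x + 2 * \int[mu]_(y in Rpos) (f y * f (x + y)).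

(* Increments h != 0 tending to 0 with tau + h >= 0: derivatives of functions
   on [0,oo) are two-sided at tau > 0 and one-sided at tau = 0. *)
Definition increments (tau : R) : set_system R :=
  within [set h | 0 <= tau + h] 0^'.

Definition has_deriv f (tau v : R) : Prop :=
  h^-1 * (f (tau + h) - f tau) @[h --> increments tau] --> v.

(* The first argument of curves p, dp : R -> R -> R is the time tau. *)
Definition has_derivL1 p (tau : R) f : Prop :=
  L1norm (fun x => h^-1 * (p (tau + h) x - p tau x) - f x)
    @[h --> increments tau] --> (0 : R).

Definition contL1 p : Prop :=
  forall tau : R, 0 <= tau ->
    L1norm (fun x => p s x - p tau x)
      @[s --> within [set s | 0 <= s] (nbhs tau)] --> (0 : R).

Definition is_solution p : Prop :=
  (forall tau : R, 0 <= tau -> prob_density (p tau)) /\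
  exists dp,
    [/\ forall tau : R, 0 <= tau -> inL1 (dp tau),
        forall tau : R, 0 <= tau -> has_derivL1 p tau (dp tau),
        contL1 dp &
        forall tau : R, 0 <= tau -> eqL1 (dp tau) (evolution_rhs (p tau))].

(* Pointwise values on (0,oo) make sense for the continuous representative of
   the L^1 class p(.,tau), which is unique on (0,oo). *)
Definition continuous_version p (q : R -> R -> R) : Prop :=
  forall tau : R, 0 <= tau ->
    (forall x : R, 0 < x -> continuous_at x (q tau)) /\ eqL1 (p tau) (q tau).

Definition expsum (N : nat) (lam a : 'I_N.+1 -> R) (x : R) : R :=
  \sum_(j < N.+1) a j * lam j * expR (- (lam j * x)).

Definition mean f : R := \int[mu]_(x in Rpos) (x * f x).

(* f ~ g at +oo, up to a nonzero (possibly negative) constant. *)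
Definition sim_pinfty f g : Prop :=
  exists2 c : R, c != 0 & f s / g s @[s --> +oo%R] --> c.

End Defs.

(* Main.v *)
Require Import Defs.
From mathcomp Require Import all_boot all_order all_algebra.
From mathcomp Require Import all_classical all_reals all_analysis.
From mathcomp Require Import measurable_realfun ring lra.
Import Order.TTheory GRing.Theory Num.Theory.
Import numFieldNormedType.Exports.
Local Open Scope classical_set_scope.
Local Open Scope ring_scope.
Set Implicit Arguments.
Unset Strict Implicit.
Unset Printing Implicit Defensive.

(** Let [m_k(t)] be the Laplace transform of [p(., t)] at [lam k]
    ([laplace (p t) (lam k)] below).  Since the correlation of [p] with
    [exp(-lam_k x)] is [m_k exp(-lam_k x)], the equation

      [q' = - q + 2 int_0^oo p(y, t) q(x + y, t) dy],

    which is linear in [q] once the solution [p] is given, acts on the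
    coefficient of [exp(-lam_k x)] as multiplication by [2 m_k - 1].  Hence
    [q = sum_k A_k lam_k exp(-lam_k x)] with
    [A_k(t) = A_k(0) exp(2 M_k(t) - t)] and [M_k] the primitive of [m_k] solves
    it, and so does [p].  Their difference vanishes at time 0, and its
    L^1 norm grows at a rate at most 3, because the correlation
    satisfies [||corr f g|| <= ||f|| ||g||] and [||p|| = 1]; so [p = q]
    ([dini_gronwall0], [linear_evolution_unique], [solution_expsum]).
    Expanding [m_k] over the exponentials turns [A_k' = A_k (2 m_k - 1)] into
    the stated system.

    For the long-time behaviour, positivity of [p] is decisive.  It makes
    [m_k <= m_0], so that [|A_k| / A_0] never increases; as the [A_k] sum to 1,
    [A_0] stays away from 0.  Then the leading exponential dominates beyond an
    abscissa independent of time, so a fixed interval keeps a definite mass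
    ([solution_mass]), which yields a uniform gap [m_0 - m_k >= delta > 0]
    ([M_gap]).  Therefore [A_k] decays exponentially for [k >= 1] and [m_k]
    converges exponentially fast to [lam_0 / (lam_0 + lam_k)]; the error is
    integrable in time, so [2 M_k(t) - t] is its limiting slope times [t] plus
    a convergent term ([exponent_cvg]).  This is the asymptotics of [A_k], from
    which those of [p], of the mean and of the original time variable follow. *)

(** * Integrable functions on the half-line *)

#[local] Instance ae_lebesgue_filter (R : realType) :
  Filter (nbhs (almost_everywhere (@lebesgue_measure R))).
Proof. exact: (ae_filter_ringOfSetsType (@lebesgue_measure R)). Qed.

Section L1.
Context {R : realType}.
Implicit Types (f g h : R -> R) (c : R).

Notation mu := (@lebesgue_measure R).
Notation Rpos := (`]0, +oo[%classic : set R).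

Definition Rint f : R := \int[mu]_(x in Rpos) f x.

Lemma RposE (x : R) : Rpos x <-> 0 < x.
Proof. by rewrite /= in_itv/= andbT. Qed.

Lemma measurable_Rpos : measurable Rpos.
Proof. exact: measurable_itv. Qed.
Hint Resolve measurable_Rpos : core.

Lemma inL1_measurable f : inL1 f -> measurable_fun Rpos f.
Proof. by move=> /integrableP[/measurable_EFinP]. Qed.

Lemma eqL1_sym f g : eqL1 f g -> eqL1 g f.
Proof. by apply: filterS => x + x0 => /(_ x0). Qed.

Lemma eqL1_trans f g h : eqL1 f g -> eqL1 g h -> eqL1 f h.
Proof. by apply: filterS2 => x + + x0 => /(_ x0) -> /(_ x0). Qed.

Lemma eqL1_eq f g : (forall x, 0 < x -> f x = g x) -> eqL1 f g.
Proof. by move=> fg; apply: aeW. Qed.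

Lemma inL1_ext f g : (forall x, 0 < x -> f x = g x) -> inL1 f -> inL1 g.
Proof.
move=> fg; apply: (@eq_integrable _ _ _ mu Rpos measurable_Rpos) => x.
by rewrite inE => /RposE x0 /=; rewrite fg.
Qed.

Lemma Rint_ext f g : (forall x, 0 < x -> f x = g x) -> Rint f = Rint g.
Proof. by move=> fg; apply: eq_Rintegral => x; rewrite inE => /RposE /fg. Qed.

Lemma inL1D f g : inL1 f -> inL1 g -> inL1 (fun x => f x + g x).
Proof. by move=> lf lg; have := @integrableD _ _ _ mu Rpos measurable_Rpos _ _
  lf lg; exact: eq_integrable. Qed.

Lemma inL1B f g : inL1 f -> inL1 g -> inL1 (fun x => f x - g x).
Proof. by move=> lf lg; have := @integrableB _ _ _ mu Rpos measurable_Rpos _ _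
  lf lg; exact: eq_integrable. Qed.

Lemma inL1Z c f : inL1 f -> inL1 (fun x => c * f x).
Proof. by move=> lf; have := @integrableZl _ _ _ mu Rpos measurable_Rpos c _
  lf; exact: eq_integrable. Qed.

Lemma inL1_norm f : inL1 f -> inL1 (fun x => `|f x|).
Proof. exact: integrable_norm. Qed.

Lemma inL10 : inL1 (fun=> 0 : R).
Proof. exact: integrable0. Qed.

Lemma inL1_sum (I : Type) (r : seq I) (F : I -> R -> R) :
  (forall i, inL1 (F i)) -> inL1 (fun x => \sum_(i <- r) F i x).
Proof.
move=> lF; elim: r => [|i r IH].
  by apply: inL1_ext inL10 => x _; rewrite big_nil.
by apply: inL1_ext (inL1D (lF i) IH) => x _; rewrite big_cons.
Qed.

Lemma inL1_le f g : measurable_fun Rpos f ->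
  {ae mu, forall x : R, 0 < x -> `|f x| <= g x} -> inL1 g -> inL1 f.
Proof.
move=> mf fg lg; apply/integrableP; split; first exact/measurable_EFinP.
have /integrableP[mg ig] := lg; apply: le_lt_trans ig.
apply: ae_ge0_le_integral => //.
- by apply: measurableT_comp => //; exact/measurable_EFinP.
- exact: measurableT_comp.
- apply: filterS fg => x + /RposE x0 => /(_ x0) fgx.
  by rewrite !abse_EFin lee_fin (le_trans fgx)// ler_norm.
Qed.

Lemma inL1_ae f g : eqL1 f g -> measurable_fun Rpos f -> inL1 g -> inL1 f.
Proof.
move=> fg mf /inL1_norm; apply: inL1_le => //.
by apply: filterS fg => x + x0 => /(_ x0) ->.
Qed.

Lemma inL1_mul_bounded f g c : inL1 f -> measurable_fun Rpos g ->
  (forall x, 0 < x -> `|g x| <= c) -> inL1 (fun x => f x * g x).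
Proof.
move=> lf mg gc; apply: inL1_le (inL1Z c (inL1_norm lf)).
  by apply: measurable_funM => //; exact: inL1_measurable.
by apply: aeW => x x0; rewrite normrM mulrC ler_wpM2r// gc.
Qed.

Lemma RintD f g : inL1 f -> inL1 g ->
  Rint (fun x => f x + g x) = Rint f + Rint g.
Proof. exact: RintegralD. Qed.

Lemma RintB f g : inL1 f -> inL1 g ->
  Rint (fun x => f x - g x) = Rint f - Rint g.
Proof. exact: RintegralB. Qed.

Lemma RintZ c f : inL1 f -> Rint (fun x => c * f x) = c * Rint f.
Proof. exact: RintegralZl. Qed.

Lemma Rint0 : Rint (fun=> 0) = 0.
Proof. by rewrite -[RHS](mul0r (Rint (fun=> 0))) -(RintZ _ inL10);
  apply: Rint_ext => x _; rewrite mul0r. Qed.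

Lemma Rint_sum (I : Type) (r : seq I) (F : I -> R -> R) :
  (forall i, inL1 (F i)) ->
  Rint (fun x => \sum_(i <- r) F i x) = \sum_(i <- r) Rint (F i).
Proof.
move=> lF; elim: r => [|i r IH].
  by rewrite big_nil -[RHS]Rint0; apply: Rint_ext => x _; rewrite big_nil.
rewrite big_cons -IH -RintD//; last exact: inL1_sum.
by apply: Rint_ext => x _; rewrite big_cons.
Qed.

Lemma Rint_ae f g : inL1 f -> inL1 g -> eqL1 f g -> Rint f = Rint g.
Proof.
move=> lf lg fg; rewrite /Rint /Rintegral; congr fine.
apply: ae_eq_integral => //.
- exact: measurable_int lf.
- exact: measurable_int lg.
- by apply: filterS fg => x + /RposE x0 => /(_ x0) ->.
Qed.

Lemma Rint_ge0_ae f : inL1 f -> {ae mu, forall x : R, 0 < x -> 0 <= f x} ->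
  0 <= Rint f.
Proof.
move=> lf f0; rewrite (@Rint_ae _ (fun x => `|f x|))//.
- by apply: Rintegral_ge0.
- exact: inL1_norm.
- by apply: filterS f0 => x + x0 => /(_ x0) fx; rewrite ger0_norm.
Qed.

Lemma le_Rint_ae f g : inL1 f -> inL1 g ->
  {ae mu, forall x : R, 0 < x -> f x <= g x} -> Rint f <= Rint g.
Proof.
move=> lf lg fg; rewrite -subr_ge0 -RintB//; apply: Rint_ge0_ae.
  exact: inL1B.
by apply: filterS fg => x + x0 => /(_ x0); rewrite subr_ge0.
Qed.

Lemma L1normE f : L1norm f = Rint (fun x => `|f x|).
Proof. by []. Qed.

Lemma L1norm_ge0 f : 0 <= L1norm f.
Proof. exact: Rintegral_ge0. Qed.

Lemma L1norm_ae f g : inL1 f -> inL1 g -> eqL1 f g -> L1norm f = L1norm g.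
Proof.
move=> lf lg fg; apply: Rint_ae; [exact: inL1_norm|exact: inL1_norm|].
by apply: filterS fg => x + x0 => /(_ x0) ->.
Qed.

Lemma L1norm_ext f g : (forall x, 0 < x -> f x = g x) -> L1norm f = L1norm g.
Proof. by move=> fg; apply: Rint_ext => x x0; rewrite fg. Qed.

Lemma L1normZ c f : inL1 f -> L1norm (fun x => c * f x) = `|c| * L1norm f.
Proof.
move=> lf; rewrite !L1normE -RintZ; last exact: inL1_norm.
by apply: Rint_ext => x _; rewrite normrM.
Qed.

Lemma ler_L1normD f g : inL1 f -> inL1 g ->
  L1norm (fun x => f x + g x) <= L1norm f + L1norm g.
Proof.
move=> lf lg; rewrite !L1normE -RintD; [|exact: inL1_norm|exact: inL1_norm].
apply: le_Rint_ae.
- by apply: inL1_norm; exact: inL1D.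
- by apply: inL1D; exact: inL1_norm.
- by apply: aeW => x _; exact: ler_normD.
Qed.

Lemma ler_norm_Rint f : inL1 f -> `|Rint f| <= L1norm f.
Proof. exact: le_normr_Rintegral. Qed.

Lemma ler_L1norm_mul f g c : inL1 f -> measurable_fun Rpos g ->
  (forall x, 0 < x -> `|g x| <= c) ->
  `|Rint (fun x => f x * g x)| <= c * L1norm f.
Proof.
move=> lf mg gc; have lfg := inL1_mul_bounded lf mg gc.
apply: (le_trans (ler_norm_Rint lfg)).
rewrite !L1normE -RintZ; last exact: inL1_norm.
apply: le_Rint_ae; [exact: inL1_norm|exact/inL1Z/inL1_norm|].
by apply: aeW => x x0; rewrite normrM mulrC ler_wpM2r// gc.
Qed.

Lemma L1norm_eq0 f : inL1 f -> L1norm f = 0 -> eqL1 f (fun=> 0).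
Proof.
move=> lf f0; have /integrableP[mf ifoo] := lf.
have : (\int[mu]_(x in Rpos) `|(EFin \o f) x| = 0)%E.
  rewrite -[LHS]fineK; last first.
    by rewrite ge0_fin_numE// integral_ge0.
  by congr EFin; exact: f0.
move/(ae_eq_integral_abs mu measurable_Rpos mf).
by apply: filterS => x + x0 => /(_ (proj2 (RposE x) x0)) [].
Qed.

End L1.
#[local] Hint Resolve measurable_Rpos : core.
(** * Correlation of integrable functions *)

Section Correlation.
Context {R : realType}.
Implicit Types (f g : R -> R).

Notation mu := (@lebesgue_measure R).
Notation Rpos := (`]0, +oo[%classic : set R).

Lemma lebesgue_measure_shift (a : R) (A : set R) : measurable A ->
  pushforward mu (fun x : measurableTypeR R => x + a : measurableTypeR R) A =
    mu A.
Proof.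
move=> mA; apply/esym/lebesgue_measure_unique => //=.
  by apply: measurable_funD => //; exact: measurable_id.
move=> _ mshift [[b c]] _ <-.
rewrite /pushforward /= (_ : _ @^-1` _ = `](b - a), (c - a)]%classic);
  last first.
  by apply/seteqP; split => x /=; rewrite !in_itv/= ltrBlDr lerBrDr.
by rewrite !lebesgue_measure_itv/= !lte_fin; congr (if _ then _ else _);
  [lra|congr EFin; ring].
Qed.

Lemma ge0_integral_shift (a : R) (f : R -> \bar R) : measurable_fun setT f ->
  (forall x, 0 <= f x)%E ->
  (\int[mu]_x f (x + a)%R = \int[mu]_x f x)%E.
Proof.
move=> mf f0.
have mshift : measurable_fun setT
    (fun x : measurableTypeR R => x + a : measurableTypeR R).
  by apply: measurable_funD => //; exact: measurable_id.
have := @ge0_integral_pushforward _ _ _ _ R _ mshift mu setT f measurableT mf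
  (fun y _ => f0 y).
rewrite preimage_setT => <-.
by apply: eq_measure_integral => A mA _; exact: lebesgue_measure_shift.
Qed.

End Correlation.

Lemma abse_fine_le (R : realType) (z : \bar R) : (`|(fine z)%:E| <= `|z|)%E.
Proof. by case: z => //= *; exact: leey. Qed.

Section Correlation_bound.
Context {R : realType}.
Implicit Types (f g : R -> R).

Notation mu := (@lebesgue_measure R).
Notation Rpos := (`]0, +oo[%classic : set R).
Notation mR := (measurableTypeR R).

Variables f g : R -> R.
Hypothesis (lf : inL1 f) (lg : inL1 g).

(* With the extensions by zero the double integral of the correlation lives on
   the whole plane, where Tonelli's theorem and translations apply. *)
Let f' : mR -> R := f \_ Rpos.
Let g' : mR -> R := g \_ Rpos.
Let H (z : mR * mR) : R := f' z.2 * g' (z.1 + z.2).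

Let mf' : measurable_fun setT f'.
Proof.
apply/(measurable_restrictT f measurable_Rpos); exact: inL1_measurable.
Qed.

Let mg' : measurable_fun setT g'.
Proof.
apply/(measurable_restrictT g measurable_Rpos); exact: inL1_measurable.
Qed.

Let mH : measurable_fun setT H.
Proof.
apply: measurable_funM; first exact: measurableT_comp mf' measurable_snd.
apply: (measurableT_comp mg').
exact: measurable_funD measurable_fst measurable_snd.
Qed.

Let normE (h : R -> R) : inL1 h ->
  (\int[mu]_x `|(h \_ Rpos) x|%:E = (L1norm h)%:E)%E.
Proof.
move=> lh; rewrite /L1norm /Rintegral fineK; last first.
  by apply: integrable_fin_num => //; exact: inL1_norm.
rewrite [RHS]integral_mkcond; apply: eq_integral => x _.
by rewrite !patchE; case: ifP => //=; rewrite normr0.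
Qed.

(* Integrating in x first leaves a factor L1norm g for each y. *)
Let HE : (\int[mu]_y \int[mu]_x `|(H (x, y))%:E| = (L1norm f * L1norm g)%:E)%E.
Proof.
transitivity (\int[mu]_y (`|f' y|%:E * (L1norm g)%:E))%E.
  apply: eq_integral => y _ /=.
  transitivity (\int[mu]_x (`|f' y|%:E * `|g' (x + y)|%:E))%E.
    by apply: eq_integral => x _; rewrite /H /= normrM.
  rewrite ge0_integralZl//=; last first.
    apply/measurable_EFinP/measurableT_comp => //.
    apply: (measurableT_comp mg'); apply: measurable_funD => //;
      exact: measurable_id.
  rewrite (@ge0_integral_shift _ y (fun x => `|g' x|%:E)) ?normE//.
  by apply/measurable_EFinP/measurableT_comp.
rewrite ge0_integralZr//=; last 2 first.
  by apply/measurable_EFinP/measurableT_comp.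
  by rewrite lee_fin L1norm_ge0.
by rewrite normE.
Qed.

Let iH : (mu \x mu)%E.-integrable setT (EFin \o H).
Proof.
apply/integrable21ltyP; first exact/measurable_EFinP.
by rewrite HE ltry.
Qed.

Let RHE (x : R) : 0 < x ->
  (fun y => (H (x, y))%:E) = (EFin \o (fun y => f y * g (x + y))) \_ Rpos.
Proof.
move=> x0; apply/funext => y; rewrite /H /f' /g' /= !patchE.
case: ifPn; rewrite ?mul0r// inE => /RposE y0.
by rewrite ifT// inE; apply/RposE; exact: addr_gt0.
Qed.

(** Almost every section of an integrable function on the plane is
    integrable. *)
Lemma ae_inL1_correlation :
  {ae mu, forall x : R, 0 < x -> inL1 (fun y => f y * g (x + y))}.
Proof.
have := @ae_integrable1 _ _ _ _ R mu mu _ iH.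
apply: filterS => x + x0; rewrite /= RHE// => ?.
by rewrite /inL1; apply/integrable_mkcond.
Qed.

Let FE (x : R) : 0 < x ->
  Rint (fun y => f y * g (x + y)) = fine (\int[mu]_y (H (x, y))%:E)%E.
Proof. by move=> x0; rewrite RHE// -integral_mkcond. Qed.

Lemma inL1_correlation : inL1 (fun x => Rint (fun y => f y * g (x + y))).
Proof.
have iF := @integrable_fubini_F _ _ _ _ R mu mu _ iH.
apply: (@inL1_ext _ (fun x => fine (\int[mu]_y (H (x, y))%:E)%E)).
  by move=> x x0; rewrite FE.
have iF' : mu.-integrable Rpos (fun x => \int[mu]_y (H (x, y))%:E)%E.
  by apply: integrableS iF.
apply/integrableP; split.
  apply/measurable_EFinP; apply: (@measurableT_comp _ _ _ _ _ _ fine) => //.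
  exact: measurable_int iF'.
have /integrableP[mF iFoo] := iF'; apply: le_lt_trans iFoo.
apply: ge0_le_integral => //.
- do 2 apply: measurableT_comp => //.
  exact: (@measurableT_comp _ _ _ _ _ _ fine).
- exact: measurableT_comp.
- move=> x _; rewrite /comp; exact: abse_fine_le.
Qed.

(** Taking the modulus inside, this is Tonelli's theorem together with the
    translation invariance of the Lebesgue measure. *)
Lemma L1norm_correlation :
  L1norm (fun x => Rint (fun y => f y * g (x + y))) <= L1norm f * L1norm g.
Proof.
rewrite -lee_fin -HE -(fubini_tonelli (fun z : mR * mR => `|(H z)%:E|%E)) //;
  last first.
  by apply: measurableT_comp => //; exact/measurable_EFinP.
have iF := @integrable_fubini_F _ _ _ _ R mu mu _ iH.
rewrite /L1norm /Rintegral fineK; last first.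
  apply: integrable_fin_num => //; exact/inL1_norm/inL1_correlation.
have mG : measurable_fun setT (fun x => \int[mu]_y `|(H (x, y))%:E|)%E.
  apply: (@measurable_fun_fubini_tonelli_F _ _ _ _ _ mu (fun z : mR * mR =>
    `|(H z)%:E|%E)) => //.
  by apply: measurableT_comp => //; exact/measurable_EFinP.
apply: (@le_trans _ _ (\int[mu]_(x in Rpos) \int[mu]_y `|(H (x, y))%:E|)%E);
  last first.
  apply: ge0_subset_integral => //.
  by move=> x _; apply: integral_ge0.
apply: ge0_le_integral => //.
- have /integrableP[+ _] := inL1_norm inL1_correlation; exact.
- exact: measurable_funTS.
- move=> x /RposE x0; rewrite -/(Rint _) FE//.
  apply: (@le_trans _ _ `|\int[mu]_y (H (x, y))%:E|%E).
    exact: abse_fine_le.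
  apply: le_abse_integral => //.
  by apply/measurable_EFinP; exact: (measurableT_comp mH (measurable_pair1 x)).
Qed.

End Correlation_bound.
(** * Exponential integrands *)

Section Exponentials.
Context {R : realType}.
Implicit Types (f F : R -> R) (l x : R).

Notation mu := (@lebesgue_measure R).
Notation Rpos := (`]0, +oo[%classic : set R).

Lemma Rint_antiderivative f F (a : R) : (forall x, 0 <= x -> 0 <= f x) ->
  continuous f -> (forall x, is_derive x 1 F (f x)) ->
  F x @[x --> +oo] --> a -> inL1 f /\ Rint f = a - F 0.
Proof.
move=> f0 cf dF Fa.
have cF : continuous F.
  by move=> x; apply/differentiable_continuous/derivable1_diffP; case: (dF x).
have mf : measurable_fun Rpos f.
  by apply: measurable_funTS; exact: continuous_measurable_fun.
have intf : (\int[mu]_(x in Rpos) (f x)%:E = a%:E - (F 0)%:E)%E.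
  rewrite integral_itv_obnd_cbnd; last exact/measurable_EFinP.
  apply: ge0_continuous_FTC2y => //.
  - exact: continuous_subspaceT.
  - exact/cvg_at_right_filter/cF.
  - by move=> x _; rewrite derive1E; exact: derive_val.
split; last by rewrite /Rint /Rintegral intf.
apply/integrableP; split; first exact/measurable_EFinP.
suff -> : (\int[mu]_(x in Rpos) `|(EFin \o f) x| = \int[mu]_(x in Rpos) (f
  x)%:E)%E.
  by rewrite intf ltry.
by apply: eq_integral => x; rewrite inE => /RposE x0;
  rewrite /= ger0_norm// f0// ltW.
Qed.

Lemma cvg_expRN l : 0 < l -> expR (- (l * x)) @[x --> +oo] --> 0.
Proof.
move=> l0; apply: (@cvg_comp _ _ _ (fun x => l * x) (fun y => expR (- y)) _
  (pinfty_nbhs R)).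
  exact: gt0_cvgMry.
exact: cvgr_expR.
Qed.

Lemma cvg_mul_expRN l : 0 < l -> x * expR (- (l * x)) @[x --> +oo] --> 0.
Proof.
move=> l0; have l20 : 0 < l / 2 by rewrite divr_gt0.
apply: (@squeeze_cvgr _ _ _ _ (fun=> 0) (fun x => 2 / l * expR (- (l / 2 *
  x)))).
- near=> x; have x0 : 0 <= x by near: x; apply: nbhs_pinfty_ge;
    rewrite num_real.
  rewrite mulr_ge0 ?expR_ge0//=.
  (* Half of the exponent absorbs the factor x, as y <= exp y. *)
  have -> : - (l * x) = - (l / 2 * x) + - (l / 2 * x) by field.
  rewrite expRD mulrA ler_wpM2r ?expR_ge0// expRN ler_pdivrMr ?expR_gt0//.
  have := expR_ge1Dx (l / 2 * x) => h.
  have -> : x = 2 / l * (l / 2 * x) by field; rewrite gt_eqF.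
  rewrite ler_wpM2l ?divr_ge0 ?(ltW l0)//.
  have -> : l / 2 * (2 / l * (l / 2 * x)) = l / 2 * x by field; rewrite gt_eqF.
  by apply: le_trans h; rewrite lerDr.
- exact: cvg_cst.
- rewrite -[X in _ --> X](mulr0 (2 / l)); apply: cvgM; first exact: cvg_cst.
  exact: cvg_expRN.
Unshelve. all: by end_near. Qed.

Lemma continuous_expRN l : continuous (fun x => expR (- (l * x))).
Proof.
move=> x; apply: continuous_comp; last exact: continuous_expR.
by apply: continuousN; apply: continuousM;
  [exact: cst_continuous|exact: cvg_id].
Qed.

Lemma is_derive_expRN l x :
  is_derive x 1 (fun x => expR (- (l * x))) (- l * expR (- (l * x))).
Proof.
have d : is_derive x 1 (fun x => - (l * x)) (- l).
  by apply: is_derive_eq; rewrite /GRing.scale /= mulr1 ?mulr0 ?addr0.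
have dE := is_derive_expR (- (l * x)).
apply: (is_derive_eq (@is_derive1_comp _ expR (fun x => - (l * x)) _ _ _ dE d)).
by rewrite mulrC.
Qed.

Lemma expRN_Rint l : 0 < l ->
  inL1 (fun x => expR (- (l * x))) /\ Rint (fun x => expR (- (l * x))) = l^-1.
Proof.
move=> l0.
have [] := @Rint_antiderivative (fun x => expR (- (l * x)))
  (fun x => - l^-1 * expR (- (l * x))) 0.
- by move=> x _; exact: expR_ge0.
- exact: continuous_expRN.
- move=> x; have := is_derive_expRN l x => ?.
  apply: is_derive_eq; rewrite /GRing.scale /=.
  by rewrite mulrA mulrNN mulVf ?gt_eqF// mul1r.
- rewrite -[X in _ --> X](mulr0 (- l^-1)); apply: cvgM; first exact: cvg_cst.
  exact: cvg_expRN.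
- by move=> ? ->; split => //; rewrite mulr0 oppr0 expR0 mulr1 opprK add0r.
Qed.

Lemma mul_expRN_Rint l : 0 < l ->
  inL1 (fun x => x * expR (- (l * x))) /\
  Rint (fun x => x * expR (- (l * x))) = l ^- 2.
Proof.
move=> l0.
have [] := @Rint_antiderivative (fun x => x * expR (- (l * x)))
  (fun x => - l^-1 * (x * expR (- (l * x))) - l ^- 2 * expR (- (l * x))) 0.
- by move=> x x0; rewrite mulr_ge0// expR_ge0.
- by move=> x; apply: cvgM; [exact: cvg_id|exact: continuous_expRN].
- move=> x; have := is_derive_expRN l x => ?.
  apply: is_derive_eq; rewrite /GRing.scale /=.
  by field; rewrite gt_eqF.
- have -> : 0 = - l^-1 * 0 - l ^- 2 * 0 :> R by rewrite !mulr0 subr0.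
  apply: cvgB; apply: cvgM; (try exact: cvg_cst).
    exact: cvg_mul_expRN.
  exact: cvg_expRN.
- by move=> ? ->; split => //; rewrite mulr0 oppr0 expR0; ring.
Qed.

End Exponentials.
(** * Curves in L^1 and uniqueness for the evolution equation *)

Section Curves.
Context {R : realType}.
Implicit Types (f g : R -> R) (p q : R -> R -> R) (t h e d : R).

Notation mu := (@lebesgue_measure R).
Notation Rpos := (`]0, +oo[%classic : set R).

Lemma cvg_incrementsP (F : R -> R) t (v : R) :
  F h @[h --> increments t] --> v <->
  (forall e, 0 < e -> exists2 d, 0 < d &
     forall h, h != 0 -> `|h| < d -> 0 <= t + h -> `|v - F h| < e).
Proof.
split=> [/cvgrPdist_lt Fv e e0|Fv].
  have := Fv _ e0; rewrite /increments /within /= => /nbhs_ballP[d /= d0 dF].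
  exists d => // h h0 hd th; apply: (dF h) => //.
  by rewrite /ball/= sub0r normrN.
apply/cvgrPdist_lt => e e0; have [d d0 dF] := Fv _ e0.
rewrite /increments; apply/nbhs_ballP; exists d => //= h.
by rewrite /ball/= sub0r normrN => hd h0 th; exact: dF.
Qed.

Lemma has_derivL1P p t f : has_derivL1 p t f <->
  (forall e, 0 < e -> exists2 d, 0 < d &
     forall h, h != 0 -> `|h| < d -> 0 <= t + h ->
       L1norm (fun x => h^-1 * (p (t + h) x - p t x) - f x) < e).
Proof.
rewrite /has_derivL1 cvg_incrementsP; split=> Fv e /Fv[d d0 dF];
  exists d => // h h0 hd th; have := dF h h0 hd th;
  by rewrite sub0r normrN ger0_norm// L1norm_ge0.
Qed.

Lemma is_derive_has_deriv (F : R -> R) t v : is_derive t 1 F v ->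
  has_deriv F t v.
Proof.
move=> dF; have dd : derivable F t 1 by case: dF.
have Fv : h^-1 *: (F (h *: 1 + t) - F t) @[h --> 0^'] --> v.
  by rewrite -(@derive_val _ _ _ _ _ _ _ dF); exact: dd.
apply: cvg_within_filter.
by under eq_fun do rewrite [t + _]addrC -[X in F (X + _)]mulr1.
Qed.

Definition curveL1 p := forall t, 0 <= t -> inL1 (p t).

Lemma inL1_quotient p t h f : curveL1 p -> 0 <= t -> 0 <= t + h -> inL1 f ->
  inL1 (fun x => h^-1 * (p (t + h) x - p t x) - f x).
Proof. by move=> lp t0 th lf; apply: inL1B => //; apply/inL1Z/inL1B;
  exact: lp. Qed.

Lemma has_derivL1D p q t f g : curveL1 p -> curveL1 q -> 0 <= t ->
  inL1 f -> inL1 g -> has_derivL1 p t f -> has_derivL1 q t g ->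
  has_derivL1 (fun s x => p s x + q s x) t (fun x => f x + g x).
Proof.
move=> lp lq t0 lf lg /has_derivL1P dp /has_derivL1P dq.
apply/has_derivL1P => e e0; have e20 : 0 < e / 2 by rewrite divr_gt0.
have [d1 d10 dp1] := dp _ e20; have [d2 d20 dq2] := dq _ e20.
exists (Num.min d1 d2); first by rewrite lt_min d10.
move=> h h0; rewrite lt_min => /andP[h1 h2] th.
rewrite (splitr e); apply: le_lt_trans (ltrD (dp1 h h0 h1 th) (dq2 h h0 h2 th)).
apply: le_trans (ler_L1normD _ _); [|exact: inL1_quotient|exact: inL1_quotient].
rewrite le_eqVlt; apply/orP; left; apply/eqP; apply: L1norm_ext => x _; ring.
Qed.

Lemma has_derivL1_scale (a : R -> R) t b f : inL1 f -> has_deriv a t b ->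
  has_derivL1 (fun s x => a s * f x) t (fun x => b * f x).
Proof.
move=> lf /cvg_incrementsP da; apply/has_derivL1P => e e0.
have e'0 : 0 < e / (L1norm f + 1) by rewrite divr_gt0// ltr_wpDl ?L1norm_ge0.
have [d d0 dh] := da _ e'0; exists d => // h h0 hd th.
have -> : L1norm (fun x => h^-1 * (a (t + h) * f x - a t * f x) - b * f x) =
    `|b - h^-1 * (a (t + h) - a t)| * L1norm f.
  rewrite -normrN -L1normZ//; apply: L1norm_ext => x _; ring.
apply: (@le_lt_trans _ _ (e / (L1norm f + 1) * L1norm f)).
  by rewrite ler_wpM2r ?L1norm_ge0// ltW// dh.
rewrite mulrAC ltr_pdivrMr ?ltr_wpDl ?L1norm_ge0//.
by rewrite ltr_pM2l// ltrDl.
Qed.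

Lemma has_derivL1_sum (I : Type) (r : seq I) (a b : I -> R -> R)
    (f : I -> R -> R) t : 0 <= t -> (forall i, inL1 (f i)) ->
  (forall i, has_deriv (a i) t (b i t)) ->
  has_derivL1 (fun s x => \sum_(i <- r) a i s * f i x) t
              (fun x => \sum_(i <- r) b i t * f i x).
Proof.
move=> t0 lf da; elim: r => [|i r IH].
  apply/has_derivL1P => e e0; exists 1 => // h _ _ _.
  rewrite (_ : L1norm _ = 0)// L1normE -[RHS]Rint0; apply: Rint_ext => x _.
  by rewrite !big_nil subrr mulr0 subr0 normr0.
have lr (c : I -> R) : inL1 (fun x => \sum_(i <- r) c i * f i x).
  by apply: inL1_sum => j; exact: inL1Z.
have := has_derivL1D (fun s _ => inL1Z (a i s) (lf i)) (fun s _ => lr (a^~ s))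
  t0
  (inL1Z (b i t) (lf i)) (lr (b^~ t)) (has_derivL1_scale (lf i) (da i)) IH.
move=> /has_derivL1P H; apply/has_derivL1P => e /H[d d0 dh].
exists d => // h h0 hd th; have := dh h h0 hd th; congr (_ < _).
by apply: L1norm_ext => x _; rewrite !big_cons.
Qed.

(** This single estimate gives both the continuity of the curve and, for
    [h > 0], a bound on the upper Dini derivative of its norm. *)
Lemma has_derivL1_incr p t f : curveL1 p -> 0 <= t -> inL1 f ->
  has_derivL1 p t f ->
  forall e, 0 < e -> exists2 d, 0 < d & forall h, `|h| < d -> 0 <= t + h ->
    L1norm (fun x => p (t + h) x - p t x) <= `|h| * (L1norm f + e).
Proof.
move=> lp t0 lf /has_derivL1P dp e /dp[d d0 dh]; exists d => // h hd th.
have [->|h0] := eqVneq h 0.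
  rewrite normr0 mul0r addr0 (_ : L1norm _ = 0)// L1normE -[RHS]Rint0.
  by apply: Rint_ext => x _; rewrite subrr normr0.
have lq := inL1_quotient lp t0 th lf.
have -> : L1norm (fun x => p (t + h) x - p t x) =
    `|h| * L1norm (fun x => f x + (h^-1 * (p (t + h) x - p t x) - f x)).
  rewrite -L1normZ; last exact: inL1D.
  by apply: L1norm_ext => x _; field.
rewrite ler_wpM2l//; apply: le_trans (ler_L1normD lf lq) _.
by rewrite lerD2l ltW// dh.
Qed.

Lemma L1norm_continuous p t f : curveL1 p -> 0 <= t -> inL1 f ->
  has_derivL1 p t f ->
  forall e, 0 < e -> exists2 d, 0 < d & forall s, 0 <= s -> `|s - t| < d ->
    L1norm (fun x => p s x - p t x) < e.
Proof.
move=> lp t0 lf dp e e0; have [d d0 dh] := has_derivL1_incr lp t0 lf dp ltr01.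
have c0 : 0 < L1norm f + 1 by rewrite ltr_wpDl// L1norm_ge0.
exists (Num.min d (e / (L1norm f + 1))); first by rewrite lt_min d0 divr_gt0.
move=> s s0; rewrite lt_min => /andP[sd se].
have := dh (s - t) sd; rewrite addrC subrK => /(_ s0) /le_lt_trans; apply.
by rewrite -ltr_pdivlMr.
Qed.

(** Compare with the barrier [eps * exp ((C + 1) t)]: where [phi] lies below it,
    the barrier grows at least as fast as [phi], so there is no first time from
    which on it is exceeded; then let [eps] tend to 0. *)
Lemma dini_gronwall0 (phi : R -> R) (C : R) : 0 <= C -> phi 0 = 0 ->
  (forall t e, 0 <= t -> 0 < e -> exists2 d, 0 < d &
     forall s, 0 <= s -> `|s - t| < d -> `|phi s - phi t| < e) ->
  (forall t e, 0 <= t -> 0 < e -> exists2 d, 0 < d &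
     forall h, 0 < h -> h < d -> phi (t + h) <= phi t + h * (C * phi t + e)) ->
  forall t, 0 <= t -> phi t <= 0.
Proof.
move=> C0 phi0 cphi gphi.
suff bar eps t : 0 < eps -> 0 <= t -> phi t <= eps * expR ((C + 1) * t).
  move=> t t0; apply/ler_addgt0Pr => e e0; rewrite add0r.
  have E0 := expR_gt0 ((C + 1) * t).
  have := bar (e / expR ((C + 1) * t)) t; rewrite divfK ?gt_eqF//.
  by apply => //; rewrite divr_gt0.
move=> eps0; pose B s := eps * expR ((C + 1) * s).
have C10 : 0 < C + 1 by rewrite ltr_wpDl.
have mB s s' : s <= s' -> B s <= B s'.
  by move=> ss'; rewrite /B ler_wpM2l ?(ltW eps0)// ler_expR ler_wpM2l// ltW.
move=> t0; rewrite leNgt; apply/negP => bad.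
pose S := [set s | 0 <= s /\ B s < phi s].
have infS : has_inf S.
  by split; [exists t|exists 0 => s []].
have T0 : 0 <= inf S by apply: lb_le_inf; [exists t|move=> s []].
have lbS s : S s -> inf S <= s by move=> Ss; apply: ge_inf => //; case: infS.
have phiT : phi (inf S) <= B (inf S).
  rewrite leNgt; apply/negP => TB.
  have Tpos : 0 < inf S.
    rewrite lt_neqAle T0 andbT; apply/eqP => T00; move: TB.
    by rewrite -T00 phi0 /B mulr0 expR0 mulr1 ltNge ltW.
  have e0 : 0 < phi (inf S) - B (inf S) by rewrite subr_gt0.
  have [d d0 dphi] := cphi _ _ T0 e0.
  pose s := Num.max 0 (inf S - d / 2).
  have sT : s < inf S by rewrite gt_max Tpos ltrBlDr ltrDl divr_gt0.
  have sS : S s.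
    split; first by rewrite le_max lexx.
    have sd : `|s - inf S| < d.
      rewrite ltr0_norm ?subr_lt0// opprB ltrBlDr.
      have : inf S - d / 2 <= s by rewrite le_max lexx orbT.
      by lra.
    have s0 : 0 <= s by rewrite le_max lexx.
    have := dphi s s0 sd; rewrite ltr_norml => /andP[h _].
    by apply: le_lt_trans (mB _ _ (ltW sT)) _; lra.
  by have := lbS _ sS; rewrite leNgt sT.
have [d d0 dg] := gphi _ _ T0 eps0.
have [s Ss sTd] := inf_adherent d0 infS.
have Ts := lbS _ Ss; have [s0 Bs] := Ss.
have [sT|sT] := eqVneq s (inf S).
  by move: Bs; rewrite sT ltNge phiT.
have h0 : 0 < s - inf S by rewrite subr_gt0 lt_neqAle eq_sym sT.
have hd : s - inf S < d by rewrite ltrBlDl.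
have := dg _ h0 hd; rewrite addrC subrK => phis.
move: Bs; rewrite ltNge => /negP; apply.
apply: (le_trans phis).
have -> : B s = B (inf S) * expR ((C + 1) * (s - inf S)).
  by rewrite /B -mulrA -expRD; congr (_ * expR _); ring.
have epsB : eps <= B (inf S).
  by rewrite /B ler_peMr ?(ltW eps0)// -[leLHS]expR0 ler_expR mulr_ge0// ltW.
have B0 : 0 < B (inf S) by exact: lt_le_trans epsB.
apply: (@le_trans _ _ (B (inf S) * (1 + (C + 1) * (s - inf S)))); last first.
  by rewrite ler_pM2l// expR_ge1Dx.
have CB : C * phi (inf S) <= C * B (inf S) by rewrite ler_wpM2l.
have : (s - inf S) * (C * phi (inf S) + eps) <=
       (s - inf S) * (C * B (inf S) + B (inf S)).
  by rewrite ler_pM2l// lerD.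
by move=> H; apply: (le_trans (lerD phiT H)); rewrite le_eqVlt; apply/orP;
  left; apply/eqP; ring.
Qed.

End Curves.

Section Uniqueness.
Context {R : realType}.
Implicit Types (f g : R -> R) (p q : R -> R -> R) (t : R).

Notation mu := (@lebesgue_measure R).
Notation Rpos := (`]0, +oo[%classic : set R).

Definition corr f g (x : R) : R := Rint (fun y => f y * g (x + y)).

Lemma prob_density_L1norm f : prob_density f -> L1norm f = 1.
Proof.
case=> lf f0 <-; apply: Rint_ae => //; first exact: inL1_norm.
by apply: filterS f0 => x + x0 => /(_ x0) fx; rewrite ger0_norm.
Qed.

(** The linear operator [g |-> - g + 2 corr f g] has norm at most
    [1 + 2 * L1norm f = 3], and its value at [f] is the right-hand side of the
    evolution equation. *)
Lemma L1norm_rhs_le f df g : inL1 f -> inL1 df -> inL1 g -> L1norm f = 1 ->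
  eqL1 df (evolution_rhs f) ->
  L1norm (fun x => df x - (- g x + 2 * corr f g x)) <=
  3 * L1norm (fun x => f x - g x).
Proof.
move=> lf ldf lg f1 dfE.
have lw : inL1 (fun x => f x - g x) by exact: inL1B.
have lc := inL1_correlation lf lw.
have lN : inL1 (fun x => -1 * (f x - g x)) by exact: inL1Z.
have l2 : inL1 (fun x => 2 * corr f (fun x => f x - g x) x) by exact: inL1Z.
rewrite (@L1norm_ae _ _ (fun x => -1 * (f x - g x) + 2 * corr f (fun x => f x -
  g x) x)).
- apply: (le_trans (ler_L1normD lN l2)).
  rewrite !L1normZ// normrN normr1 mul1r (ger0_norm (ler0n _ 2)).
  have := L1norm_correlation lf lw; rewrite f1 mul1r -/(corr _ _) => H.
  by move: H; set a := L1norm _; set b := L1norm _ => H; lra.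
- apply: inL1B => //; apply: inL1D; last exact/inL1Z/inL1_correlation.
  by apply: inL1_ext (inL1Z (-1) lg) => x _; rewrite mulN1r.
- exact: inL1D.
- have := ae_inL1_correlation lf lg; have := ae_inL1_correlation lf lf.
  move=> H1 H2; apply: filterS3 dfE H1 H2 => x + + + x0 => /(_ x0) -> /(_ x0)
    i1 /(_ x0) i2.
  have -> : corr f (fun x => f x - g x) x = corr f f x - corr f g x.
    by rewrite /corr -RintB//; apply: Rint_ext => y _; rewrite mulrBr.
  rewrite /evolution_rhs -[Rintegral _ _ _]/(corr f f x); ring.
Qed.

(** Freezing one factor of the quadratic term at the solution itself makes
    the equation linear, and the difference of two solutions of the linear
    equation vanishes by a Gronwall argument for its norm. *)
Lemma linear_evolution_unique p q : is_solution p -> curveL1 q ->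
  (forall t, 0 <= t ->
     has_derivL1 q t (fun x => - q t x + 2 * corr (p t) (q t) x)) ->
  eqL1 (p 0) (q 0) -> forall t, 0 <= t -> eqL1 (p t) (q t).
Proof.
move=> [pd [dp [ldp hdp _ dpE]]] lq hdq pq0.
have lp : curveL1 p by move=> t t0; have [] := pd t t0.
pose w s x := p s x + -1 * q s x.
have lNq : curveL1 (fun s x => -1 * q s x) by move=> t t0; exact/inL1Z/lq.
have lw : curveL1 w by move=> t t0; apply: inL1D; [exact: lp|exact: lNq].
have lg t : 0 <= t -> inL1 (fun x => - q t x + 2 * corr (p t) (q t) x).
  move=> t0; apply: inL1D; last first.
    by apply/inL1Z/inL1_correlation; [exact: lp|exact: lq].
  by apply: inL1_ext (lNq t t0) => x _; rewrite mulN1r.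
pose v s x := dp s x + -1 * (- q s x + 2 * corr (p s) (q s) x).
have lv t : 0 <= t -> inL1 (v t).
  by move=> t0; apply: inL1D; [exact: ldp|exact/inL1Z/lg].
have hdw t : 0 <= t -> has_derivL1 w t (v t).
  move=> t0; apply: has_derivL1D => //; [exact: ldp|exact/inL1Z/lg|exact: hdp|].
  apply/has_derivL1P => e /((has_derivL1P _ _ _).1 (hdq t t0))[d d0 dh].
  exists d => // h h0 hd th; apply: le_lt_trans (dh h h0 hd th).
  rewrite -[leRHS]mul1r -[X in X * _](normrN1 R) -L1normZ; last first.
    exact: (inL1_quotient lq t0 th (lg t t0)).
  rewrite le_eqVlt; apply/orP; left; apply/eqP; apply: L1norm_ext => x _; ring.
have vw t : 0 <= t -> L1norm (v t) <= 3 * L1norm (w t).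
  move=> t0.
  rewrite (@L1norm_ext _ (v t) (fun x => dp t x - (- q t x + 2 * corr (p t) (q
    t) x))); last first.
    by move=> x _; rewrite /v mulN1r.
  rewrite (@L1norm_ext _ (w t) (fun x => p t x - q t x)); last first.
    by move=> x _; rewrite /w mulN1r.
  apply: L1norm_rhs_le; [exact: lp|exact: ldp|exact: lq| |exact: dpE].
  exact/prob_density_L1norm/pd.
have w0 : L1norm (w 0) = 0.
  rewrite (@L1norm_ae _ _ (fun=> 0)); [|exact: lw|exact: inL10|].
    by rewrite L1normE -[RHS]Rint0; apply: Rint_ext => x _; rewrite normr0.
  by apply: filterS pq0 => x + x0 => /(_ x0) pqx; rewrite /w pqx mulN1r subrr.
have triangle s t : 0 <= s -> 0 <= t ->
    L1norm (w s) <= L1norm (w t) + L1norm (fun x => w s x - w t x).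
  move=> s0 t0; apply: le_trans (ler_L1normD (lw t t0) (inL1B (lw s s0) (lw t
    t0))).
  rewrite le_eqVlt; apply/orP; left; apply/eqP; apply: L1norm_ext => x _; ring.
have normw s t : 0 <= s -> 0 <= t ->
    L1norm (fun x => w s x - w t x) = L1norm (fun x => w t x - w s x).
  by move=> s0 t0; rewrite !L1normE; apply: Rint_ext => x _; rewrite distrC.
have Z : forall t, 0 <= t -> L1norm (w t) <= 0.
  apply: (@dini_gronwall0 _ _ 3) => //.
  - move=> t e t0 e0.
    have [d d0 dh] := L1norm_continuous lw t0 (lv t t0) (hdw t t0) e0.
    exists d => // s s0 st; have := dh s s0 st.
    have := triangle s t s0 t0; have := triangle t s t0 s0; rewrite normw//.
    by rewrite ltr_norml => A B C; apply/andP; split; lra.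
  - move=> t e t0 e0.
    have [d d0 dh] := has_derivL1_incr lw t0 (lv t t0) (hdw t t0) e0.
    exists d => // h h0 hd; have th : 0 <= t + h by rewrite addr_ge0// ltW.
    apply: (le_trans (triangle (t + h) t th t0)); rewrite lerD2l.
    have := dh h; rewrite gtr0_norm// => /(_ hd th) /le_trans; apply.
    by rewrite ler_pM2l// lerD2r vw.
move=> t t0; have wt0 : L1norm (w t) = 0.
  by apply/le_anti; rewrite Z// L1norm_ge0.
apply: filterS (L1norm_eq0 (lw t t0) wt0) => x + x0 => /(_ x0).
by rewrite /w mulN1r => /eqP; rewrite subr_eq0 => /eqP.
Qed.

End Uniqueness.
(** * The solution is a sum of exponentials *)

Section Laplace.
Context {R : realType}.
Implicit Types (f g : R -> R) (l : R).

Notation mu := (@lebesgue_measure R).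
Notation Rpos := (`]0, +oo[%classic : set R).

Definition laplace f l : R := Rint (fun y => f y * expR (- (l * y))).

Lemma expRN_norm_le1 l (x : R) : 0 <= l -> 0 < x -> `|expR (- (l * x))| <= 1.
Proof.
move=> l0 x0; rewrite ger0_norm ?expR_ge0// -[leRHS]expR0 ler_expR oppr_le0.
by rewrite mulr_ge0// ltW.
Qed.

Lemma measurable_expRN l : measurable_fun Rpos (fun x => expR (- (l * x))).
Proof.
by apply: measurable_funTS; apply: continuous_measurable_fun;
  exact: continuous_expRN.
Qed.

Lemma inL1_laplace f l : inL1 f -> 0 <= l ->
  inL1 (fun y => f y * expR (- (l * y))).
Proof.
move=> lf l0; apply: (inL1_mul_bounded lf (measurable_expRN l)).
by move=> x; exact: expRN_norm_le1.
Qed.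

Lemma laplace_ae f g l : inL1 f -> inL1 g -> 0 <= l -> eqL1 f g ->
  laplace f l = laplace g l.
Proof.
move=> lf lg l0 fg; apply: Rint_ae; [exact: inL1_laplace|exact: inL1_laplace|].
by apply: filterS fg => x + x0 => /(_ x0) ->.
Qed.

Lemma ler_laplaceB f g l : inL1 f -> inL1 g -> 0 <= l ->
  `|laplace f l - laplace g l| <= L1norm (fun x => f x - g x).
Proof.
move=> lf lg l0; rewrite /laplace -RintB; [|exact: inL1_laplace|exact:
  inL1_laplace].
rewrite -[leRHS]mul1r.
apply: le_trans (ler_L1norm_mul (inL1B lf lg) (measurable_expRN l)
  (fun x x0 => expRN_norm_le1 l0 x0)).
rewrite le_eqVlt; apply/orP; left; apply/eqP; congr (`| _ |).
by apply: Rint_ext => x _; rewrite mulrBl.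
Qed.

End Laplace.

(** Extending [g] to the left by the constant [g 0] and integrating from [-1]
    makes 0 an interior point, so the derivative there is two-sided. *)
Lemma antiderivative_nneg (R : realType) (g : R -> R) :
  (forall t e : R, 0 <= t -> 0 < e -> exists2 d : R, 0 < d &
     forall s : R, 0 <= s -> `|s - t| < d -> `|g s - g t| < e) ->
  exists2 G : R -> R, G 0 = 0 & forall t : R, 0 <= t -> is_derive t 1 G (g t).
Proof.
move=> cg; pose g' (s : R) : R := g (Num.max 0 s).
have cg' : continuous g'.
  move=> t; apply/cvgrPdist_lt => e e0.
  have m0 s : 0 <= Num.max 0 s :> R by rewrite le_max lexx.
  have [d d0 dg] := cg _ e (m0 t) e0.
  apply/nbhs_ballP; exists d => //= s; rewrite /ball/= => ts.
  rewrite distrC; apply: dg => //; apply: le_lt_trans ts; rewrite distrC.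
  have h1 := ler_norm (s - t); have h2 := ler_norm (t - s).
  have h3 := distrC s t; rewrite ler_norml; apply/andP.
  by case: (ltP 0 s) => ?; case: (ltP 0 t) => ?; split; lra.
pose G (t : R) : R := \int[lebesgue_measure]_(s in `[-1, t]) g' s.
exists (fun t : R => G t - G 0); first by rewrite subrr.
move=> t t0.
have [dG GE] : derivable G t 1 /\ G^`()%classic t = g' t.
  apply: (@continuous_FTC1 _ g' (BLeft (-1)) t (t + 1)).
  - by rewrite ltrDl.
  - apply: continuous_compact_integrable; first exact: segment_compact.
    exact: continuous_subspaceT.
  - by rewrite lte_fin (lt_le_trans _ t0)// ltrN10.
  - exact: cg'.
have : is_derive t 1 G (g t).
  by apply: DeriveDef => //; rewrite -derive1E GE /g'; congr g; apply/max_idPr.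
by move=> ?; apply: is_derive_eq; rewrite subr0.
Qed.

Section Exponential_solution.
Context {R : realType}.
Implicit Types (f : R -> R) (p : R -> R -> R) (l t x : R).

Notation mu := (@lebesgue_measure R).
Notation Rpos := (`]0, +oo[%classic : set R).

Lemma is_derive_mulexpR (M : R -> R) (a m t : R) : is_derive t 1 M m ->
  is_derive t 1 (fun s => a * expR (2 * M s - s))
                (a * expR (2 * M t - t) * (2 * m - 1)).
Proof.
move=> dM; have d : is_derive t 1 (fun s => 2 * M s - s) (2 * m - 1).
  by apply: is_derive_eq; rewrite /GRing.scale /=; ring.
have dE := is_derive_expR (2 * M t - t).
have := @is_derive1_comp _ expR (fun s => 2 * M s - s) _ _ _ dE d => ?.
by apply: is_derive_eq; rewrite /GRing.scale /=; ring.
Qed.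

Lemma inL1_expsum N (lam a : 'I_N.+1 -> R) : (forall j, 0 < lam j) ->
  inL1 (expsum lam a).
Proof.
move=> lam0; apply: inL1_sum => j; apply: inL1Z.
exact: (expRN_Rint (lam0 j)).1.
Qed.

Lemma corr_expsum f N (lam a : 'I_N.+1 -> R) x : inL1 f ->
  (forall j, 0 < lam j) ->
  corr f (expsum lam a) x =
  \sum_k a k * lam k * laplace f (lam k) * expR (- (lam k * x)).
Proof.
move=> lf lam0; have ll k := inL1_laplace lf (ltW (lam0 k)).
transitivity (Rint (fun y => \sum_k a k * lam k * expR (- (lam k * x)) *
    (f y * expR (- (lam k * y))))).
  apply: Rint_ext => y _; rewrite /expsum mulr_sumr; apply: eq_bigr => k _.
  by rewrite mulrDr opprD expRD; ring.
rewrite Rint_sum; last by move=> k; exact: inL1Z.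
by apply: eq_bigr => k _; rewrite RintZ// mulrAC.
Qed.

Lemma Rint_expsum N (lam a : 'I_N.+1 -> R) : (forall j, 0 < lam j) ->
  Rint (expsum lam a) = \sum_k a k.
Proof.
move=> lam0; have lE k := expRN_Rint (lam0 k).
rewrite /expsum Rint_sum => [|k]; last by apply: inL1Z; have [] := lE k.
apply: eq_bigr => k _; have [lk lkE] := lE k.
by rewrite RintZ// lkE mulfK// gt_eqF.
Qed.

Lemma laplace_expsum N (lam a : 'I_N.+1 -> R) l : (forall j, 0 < lam j) ->
  0 <= l -> laplace (expsum lam a) l = \sum_k a k * (lam k / (lam k + l)).
Proof.
move=> lam0 l0; have lE k := expRN_Rint (ltr_wpDr l0 (lam0 k)).
transitivity (Rint (fun y => \sum_k a k * lam k * expR (- ((lam k + l) * y)))).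
  apply: Rint_ext => y _; rewrite /expsum mulr_suml; apply: eq_bigr => k _.
  by rewrite mulrDl opprD expRD mulrA.
rewrite Rint_sum => [|k]; last by apply: inL1Z; have [] := lE k.
by apply: eq_bigr => k _; have [lk lkE] := lE k; rewrite RintZ// lkE mulrA.
Qed.

Lemma mul_expsum_Rint N (lam a : 'I_N.+1 -> R) : (forall j, 0 < lam j) ->
  inL1 (fun x => x * expsum lam a x) /\ mean (expsum lam a) = \sum_k a k / lam
    k.
Proof.
move=> lam0; have lE k := mul_expRN_Rint (lam0 k).
have E x : 0 < x -> \sum_k a k * lam k * (x * expR (- (lam k * x))) = x *
  expsum lam a x.
  by move=> _; rewrite /expsum mulr_sumr; apply: eq_bigr => k _; ring.
have ls k : inL1 (fun x => a k * lam k * (x * expR (- (lam k * x)))).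
  by apply: inL1Z; have [] := lE k.
split; first by apply: inL1_ext E _; exact: inL1_sum.
rewrite /mean -[Rintegral _ _ _]/(Rint (fun x => x * expsum lam a x))
  -(Rint_ext E).
rewrite Rint_sum//; apply: eq_bigr => k _; have [lk lkE] := lE k.
by rewrite RintZ// lkE; field; rewrite gt_eqF.
Qed.

Lemma solution_laplace_continuous p l : is_solution p -> 0 <= l ->
  forall t e : R, 0 <= t -> 0 < e -> exists2 d : R, 0 < d &
    forall s, 0 <= s -> `|s - t| < d -> `|laplace (p s) l - laplace (p t) l| <
      e.
Proof.
move=> [pd [dp [ldp hdp _ _]]] l0 t e t0 e0.
have lp : curveL1 p by move=> s s0; have [] := pd s s0.
have [d d0 dh] := L1norm_continuous lp t0 (ldp t t0) (hdp t t0) e0.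
exists d => // s s0 st; apply: le_lt_trans (dh s s0 st).
by apply: ler_laplaceB => //; exact: lp.
Qed.

(** The linear equation decouples on exponentials: the coefficient of
    [expR (- (lam k * x))] obeys a scalar linear equation whose rate is read
    off the Laplace transform of the given solution [p], and is therefore the
    exponential of an integral. *)
Lemma solution_expsum N (lam A0 : 'I_N.+1 -> R) p : (forall j, 0 < lam j) ->
  is_solution p -> eqL1 (p 0) (expsum lam A0) ->
  exists M : 'I_N.+1 -> R -> R,
    [/\ forall k, M k 0 = 0,
        forall k t, 0 <= t -> is_derive t 1 (M k) (laplace (p t) (lam k)) &
        forall t, 0 <= t ->
          eqL1 (p t) (expsum lam (fun k => A0 k * expR (2 * M k t - t)))].
Proof.
move=> lam0 sol p0.
have /choice[M HM] (k : 'I_N.+1) : exists G : R -> R, G 0 = 0 /\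
    forall t, 0 <= t -> is_derive t 1 G (laplace (p t) (lam k)).
  have [G G0 dG] := antiderivative_nneg
    (solution_laplace_continuous sol (ltW (lam0 k))).
  by exists G.
exists M; split; [by move=> k; have [] := HM k|by move=> k; have [] := HM k|].
pose A k t := A0 k * expR (2 * M k t - t).
pose q t := expsum lam (A^~ t).
have [pd _] := sol.
have lE k : inL1 (fun x => expR (- (lam k * x))) := (expRN_Rint (lam0 k)).1.
apply: (linear_evolution_unique (q := q) sol).
- by move=> t _; exact: inL1_expsum.
- move=> t t0; have [lp _ _] := pd t t0.
  have dA k : has_deriv (A k) t (A k t * (2 * laplace (p t) (lam k) - 1)).
    by apply/is_derive_has_deriv/is_derive_mulexpR; have [_] := HM k; apply.
  have := has_derivL1_sum (index_enum 'I_N.+1) (f := fun k x => lam k * expR (-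
    (lam k * x)))
    (b := fun k t => A k t * (2 * laplace (p t) (lam k) - 1)) t0 (fun k =>
      inL1Z _ (lE k)) dA.
  move=> /has_derivL1P dq; apply/has_derivL1P => e /dq[d d0 dh].
  exists d => // h h0 hd th; have := dh h h0 hd th; congr (_ < _).
  apply: L1norm_ext => x x0.
  have -> : corr (p t) (q t) x =
      \sum_k A k t * lam k * (laplace (p t) (lam k) * expR (- (lam k * x))).
    by rewrite corr_expsum//; apply: eq_bigr => k _; rewrite mulrA.
  congr (_ * (_ - _) - _).
  + by rewrite /q /expsum; apply: eq_bigr => k _; rewrite mulrA.
  + by rewrite /q /expsum; apply: eq_bigr => k _; rewrite mulrA.
  + rewrite mulr_sumr /q /expsum -sumrN -big_split /=.
    by apply: eq_bigr => k _; ring.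
- apply: eqL1_trans p0 _; apply: eqL1_eq => x _; rewrite /q /expsum.
  apply: eq_bigr => k _; rewrite /A; have [-> _] := HM k.
  by rewrite mulr0 subr0 expR0 mulr1.
Qed.

End Exponential_solution.
(** * Long-time behaviour *)

Section Real_limits.
Context {R : realType}.
Implicit Types (F f : R -> R).

Lemma is_derive_ge0_le F f : (forall t : R, 0 <= t -> is_derive t 1 F (f t)) ->
  (forall t : R, 0 <= t -> 0 <= f t) ->
  forall s t : R, 0 <= s -> s <= t -> F s <= F t.
Proof.
move=> dF f0 s t s0; rewrite le_eqVlt => /predU1P[->//|st].
have dF' (x : R) : x \in `]s, t[ -> is_derive x 1 F (f x).
  by rewrite in_itv/= => /andP[sx _]; apply: dF; rewrite (le_trans s0)// ltW.
have [|c] := MVT st dF'.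
  apply: derivable_within_continuous => x; rewrite in_itv/= => /andP[sx _].
  by case: (dF x (le_trans s0 sx)).
rewrite in_itv/= => /andP[sc _] FE; rewrite -subr_ge0 FE mulr_ge0//.
  by rewrite f0// (le_trans s0)// ltW.
by rewrite subr_ge0 ltW.
Qed.

Lemma nondecreasing_nneg_cvg F (b : R) :
  (forall s t : R, 0 <= s -> s <= t -> F s <= F t) ->
  (forall t : R, 0 <= t -> F t <= b) -> exists l : R, F t @[t --> +oo] --> l.
Proof.
move=> ndF Fb; pose F' (t : R) :=  F (Num.max 0 t).
have m0 (t : R) : 0 <= Num.max 0 t by rewrite le_max lexx.
have ndF' : nondecreasing_fun F'.
  by move=> s t st; apply: ndF => //; rewrite le_max2.
have ubF' : has_ubound (range F') by exists b => _ [t _ <-]; exact: Fb.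
exists (sup (range F')); apply: cvg_trans (nondecreasing_cvgr ndF' ubF').
apply: near_eq_cvg; near=> t; rewrite /F' max_r.
  by [].
by near: t; apply: nbhs_pinfty_ge; rewrite num_real.
Unshelve. all: by end_near. Qed.

(** Adding to [F] the primitive [- (C / d) * expR (- (d * t))] of the bound
    gives a nondecreasing function, subtracting it a nonincreasing one, and
    the primitive tends to 0. *)
Lemma is_derive_expRN_cvg F f (C d : R) : 0 < d ->
  (forall t : R, 0 <= t -> is_derive t 1 F (f t)) ->
  (forall t : R, 0 <= t -> `|f t| <= C * expR (- (d * t))) ->
  exists l : R, F t @[t --> +oo] --> l.
Proof.
move=> d0 dF fC.
have d' := fun t => is_derive_expRN d t.
have dneq0 : d != 0 by rewrite gt_eqF.
have dU (t : R) : 0 <= t -> is_derive t 1 (fun s => F s - C / d * expR (- (d *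
  s)))
    (f t + C * expR (- (d * t))).
  move=> t0; have := dF t t0; have := d' t => ? ?.
  by apply: is_derive_eq; rewrite /GRing.scale /=; field.
have dL (t : R) : 0 <= t -> is_derive t 1 (fun s => - F s - C / d * expR (- (d
  * s)))
    (- f t + C * expR (- (d * t))).
  move=> t0; have := dF t t0; have := d' t => ? ?.
  by apply: is_derive_eq; rewrite /GRing.scale /=; field.
have fC' (t : R) : 0 <= t -> - (C * expR (- (d * t))) <= f t <= C * expR (- (d
  * t)).
  by move=> t0; rewrite -ler_norml fC.
have C0 : 0 <= C.
  have := fC 0 (lexx 0); rewrite mulr0 oppr0 expR0 mulr1.
  exact: le_trans.
have ndU := is_derive_ge0_le dU (fun t t0 => ltac:(have /andP[] := fC' t t0;
  lra)).
have ndL := is_derive_ge0_le dL (fun t t0 => ltac:(have /andP[] := fC' t t0;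
  lra)).
have [|l Hl] := nondecreasing_nneg_cvg (b := F 0 + C / d) ndU.
  move=> t t0; have := ndL _ t (lexx 0) t0.
  rewrite mulr0 oppr0 expR0 mulr1 => H.
  have : 0 <= C / d * expR (- (d * t)).
    by rewrite mulr_ge0 ?expR_ge0// divr_ge0// ltW.
  by move: H; lra.
exists l; rewrite (_ : F = fun t => (F t - C / d * expR (- (d * t))) +
    C / d * expR (- (d * t))); last by apply/funext => t; ring.
rewrite -[l]addr0; apply: cvgD => //.
rewrite -[X in _ --> X](mulr0 (C / d)); apply: cvgM; first exact: cvg_cst.
exact: cvg_expRN.
Qed.

Lemma cvg_sumr (T : Type) (G : set_system T) {FG : Filter G} (I : Type)
    (r : seq I) (P : pred I) (f : I -> T -> R) (l : I -> R) :
  (forall i, P i -> f i x @[x --> G] --> l i) ->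
  \sum_(i <- r | P i) f i x @[x --> G] --> \sum_(i <- r | P i) l i.
Proof.
move=> fl; elim: r => [|i r IH].
  by rewrite big_nil; under eq_fun do rewrite big_nil; exact: cvg_cst.
have [Pi|/negPf nPi] := boolP (P i); rewrite big_cons.
  by rewrite Pi; under eq_fun do rewrite big_cons Pi; apply: cvgD => //;
    exact: fl.
by rewrite nPi; under eq_fun do rewrite big_cons nPi.
Qed.

Lemma cvg_sum_expRN (I : Type) (r : seq I) (P : pred I) (c l : I -> R) :
  (forall i, P i -> 0 < l i) ->
  \sum_(i <- r | P i) c i * expR (- (l i * x)) @[x --> +oo] --> 0.
Proof.
move=> l0; have E : \sum_(i <- r | P i) c i * 0 = 0.
  by rewrite big1// => i _; rewrite mulr0.
have := @cvg_sumr _ (pinfty_nbhs R) _ _ r P (fun i x => c i * expR (- (l i *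
  x))) (fun i => c i * 0).
rewrite E; apply => i Pi; apply: cvgM; first exact: cvg_cst.
exact/cvg_expRN/l0.
Qed.

End Real_limits.

Section Leading_exponential.
Context {R : realType}.
Variables (N : nat) (lam : 'I_N.+1 -> R).
Hypothesis lam_incr : forall i j : 'I_N.+1, (i < j)%N -> lam i < lam j.

Lemma lam_gap (k : 'I_N.+1) : k != ord0 -> 0 < lam k - lam ord0.
Proof. by move=> k0; rewrite subr_gt0; apply: lam_incr; rewrite lt0n. Qed.

Lemma expsum_factor (a : 'I_N.+1 -> R) (x : R) :
  expsum lam a x = expR (- (lam ord0 * x)) * (a ord0 * lam ord0 +
    \sum_(k | k != ord0) a k * lam k * expR (- ((lam k - lam ord0) * x))).
Proof.
rewrite /expsum (bigD1 ord0)//= mulrDr mulrC; congr (_ + _).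
rewrite mulr_sumr; apply: eq_bigr => k _.
rewrite mulrCA -expRD; congr (_ * expR _); ring.
Qed.

(** The leading exponential being factored out, the rest tends to the leading
    coefficient as [x] goes to infinity. *)
Lemma leading_coef_ge0 (a : 'I_N.+1 -> R) : 0 < lam ord0 ->
  (forall x, 0 < x -> 0 <= expsum lam a x) -> 0 <= a ord0.
Proof.
move=> l0 a0; rewrite -(pmulr_lge0 _ l0).
have H : (a ord0 * lam ord0 +
    \sum_(k | k != ord0) a k * lam k * expR (- ((lam k - lam ord0) * x)))
    @[x --> +oo] --> a ord0 * lam ord0 + 0.
  by apply: cvgD; [exact: cvg_cst|apply: cvg_sum_expRN; exact: lam_gap].
rewrite -[leRHS]addr0; apply: (cvgr_to_ge H); near=> x.
have : 0 <= expsum lam a x.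
  by apply: a0; near: x; apply: nbhs_pinfty_gt; rewrite num_real.
by rewrite expsum_factor pmulr_rge0 ?expR_gt0.
Unshelve. all: by end_near. Qed.

(** Coefficients bounded relatively to the leading one give a common abscissa
    beyond which the leading exponential dominates. *)
Lemma expsum_tail_ge (b : 'I_N.+1 -> R) : 0 < lam ord0 ->
  exists2 X : R, 0 < X & forall (a : 'I_N.+1 -> R),
    0 < a ord0 -> (forall k, `|a k| <= b k * a ord0) ->
    forall x, X <= x ->
    a ord0 * (lam ord0 / 2 * expR (- (lam ord0 * x))) <= expsum lam a x.
Proof.
move=> l0.
have H : (\sum_(k | k != ord0) b k * lam k * expR (- ((lam k - lam ord0) * x)))
    @[x --> +oo] --> 0.
  by apply: cvg_sum_expRN; exact: lam_gap.
have l20 : 0 < lam ord0 / 2 by rewrite divr_gt0.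
have [X0 [_ X0H]] := cvgr_lt _ H _ l20.
exists (Num.max X0 0 + 1) => [|a a0 ab x Xx].
  by rewrite ltr_wpDl// le_max lexx orbT.
have x0 : X0 < x.
  apply: lt_le_trans Xx; apply: (@le_lt_trans _ _ (Num.max X0 0)).
    by rewrite le_max lexx.
  by rewrite ltrDl.
have /= := X0H _ x0; set S := \sum_(k | _) _ => HS.
rewrite expsum_factor.
set T := \sum_(k | _) _.
have TS : `|T| <= a ord0 * S.
  apply: (le_trans (ler_norm_sum _ _ _)); rewrite /S mulr_sumr.
  apply: ler_sum => k k0; have lk : 0 < lam k by have := lam_gap k0; lra.
  rewrite !normrM (gtr0_norm lk) (ger0_norm (expR_ge0 _)) !mulrA.
  by rewrite ler_wpM2r ?expR_ge0// ler_wpM2r ?(ltW lk)// [leRHS]mulrC ab.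
have aS : a ord0 * S <= a ord0 * (lam ord0 / 2) by rewrite ler_pM2l// ltW.
have T0 : - T <= `|T| by rewrite -normrN ler_norm.
rewrite [_ / 2 * _]mulrC mulrCA ler_wpM2l ?expR_ge0//; lra.
Qed.

End Leading_exponential.

Section Long_time.
Context {R : realType}.
Implicit Types (t x l : R).

Notation mu := (@lebesgue_measure R).
Notation Rpos := (`]0, +oo[%classic : set R).

Lemma Rint_indic_unit (X : R) : 0 < X ->
  inL1 (\1_(`[X, X + 1]%classic : set R)) /\
  Rint (\1_(`[X, X + 1]%classic : set R)) = 1.
Proof.
move=> X0; split.
  apply: integrableS (integrable_indic_itv X (X + 1) true false) => //.
rewrite /Rint /Rintegral integral_indic//= setIidl.
  by rewrite lebesgue_measure_itv/= lte_fin ltrDl ltr01 -EFinB/= addrAC subrr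
    add0r.
by move=> x /=; rewrite !in_itv/= andbT => /andP[Xx _]; exact: lt_le_trans Xx.
Qed.

Lemma laplace_le f l l' : inL1 f -> {ae mu, forall x : R, 0 < x -> 0 <= f x} ->
  0 <= l -> l <= l' -> laplace f l' <= laplace f l.
Proof.
move=> lf f0 l0 ll'; have l'0 := le_trans l0 ll'.
apply: le_Rint_ae; [exact: inL1_laplace|exact: inL1_laplace|].
apply: filterS f0 => x + x0 => /(_ x0) fx; apply: ler_wpM2l => //.
by rewrite ler_expR lerN2 ler_wpM2r// ltW.
Qed.

Variables (N : nat) (lam A0 : 'I_N.+1 -> R) (p : R -> R -> R).
Variable M : 'I_N.+1 -> R -> R.
Hypotheses (lam0_gt0 : 0 < lam ord0)
  (lam_incr : forall i j : 'I_N.+1, (i < j)%N -> lam i < lam j)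
  (A0_gt0 : 0 < A0 ord0)
  (p_density : forall t, 0 <= t -> prob_density (p t))
  (M0 : forall k, M k 0 = 0)
  (dM : forall k t, 0 <= t -> is_derive t 1 (M k) (laplace (p t) (lam k)))
  (pE : forall t, 0 <= t ->
    eqL1 (p t) (expsum lam (fun k => A0 k * expR (2 * M k t - t)))).

Local Notation A := (fun k t => A0 k * expR (2 * M k t - t)).

Lemma lam_gt0 j : 0 < lam j.
Proof.
have [->//|j0] := eqVneq j ord0.
by have := lam_gap lam_incr j0; move: lam0_gt0; lra.
Qed.

Lemma inord1_val (k : 'I_N.+1) : k != ord0 -> (inord 1 : 'I_N.+1) = 1%N :> nat.
Proof.
move=> k0; rewrite inordK//; apply: leq_ltn_trans (ltn_ord k).
by rewrite lt0n.
Qed.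

Lemma inord1_neq0 (k : 'I_N.+1) : k != ord0 -> (inord 1 : 'I_N.+1) != ord0.
Proof. by move=> /inord1_val k1; rewrite -val_eqE /= k1. Qed.

Lemma lam_ge1 (k : 'I_N.+1) : k != ord0 -> lam (inord 1) <= lam k.
Proof.
move=> k0; have [<-//|k1] := eqVneq (inord 1) k.
apply/ltW/lam_incr; rewrite (inord1_val k0) ltn_neqAle -{1}(inord1_val k0)
  val_eqE.
by rewrite k1 lt0n.
Qed.

Lemma solution_inL1 t : 0 <= t -> inL1 (p t).
Proof. by move=> /p_density[]. Qed.

Lemma coef_sum t : 0 <= t -> \sum_k A k t = 1.
Proof.
move=> t0; have [lp _ p1] := p_density t0.
transitivity (Rint (expsum lam (fun k => A k t))).
  by rewrite Rint_expsum//; exact: lam_gt0.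
rewrite -[RHS]p1; apply: Rint_ae => //; first by apply: inL1_expsum;
  exact: lam_gt0.
by apply: eqL1_sym; exact: pE.
Qed.

Lemma coef0_gt0 t : 0 < A ord0 t.
Proof. by rewrite mulr_gt0 ?expR_gt0. Qed.

(** Each [M k] has derivative [laplace (p t) (lam k)], which is nonincreasing
    in the rate because the density is nonnegative. *)
Lemma M_le k t : 0 <= t -> M k t <= M ord0 t.
Proof.
move=> t0; rewrite -subr_ge0.
have dD (s : R) : 0 <= s -> is_derive s 1 (fun s : R => M ord0 s - M k s)
    (laplace (p s) (lam ord0) - laplace (p s) (lam k)).
  by move=> s0; have := dM ord0 s0; have := dM k s0 => ? ?; apply: is_derive_eq.
have := is_derive_ge0_le dD _ (lexx 0) t0; rewrite !M0 subrr; apply.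
move=> s s0; rewrite subr_ge0; have [lp p0 _] := p_density s0.
apply: laplace_le => //; first exact: ltW.
have [->//|k0] := eqVneq k ord0; have := lam_gap lam_incr k0; lra.
Qed.

Lemma coef_ratio k t :
  `|A k t| = `|A0 k| / A0 ord0 * expR (- (2 * (M ord0 t - M k t))) * A ord0 t.
Proof.
rewrite normrM (ger0_norm (expR_ge0 _)).
transitivity (`|A0 k| * (expR (- (2 * (M ord0 t - M k t))) * expR (2 * M ord0 t
  - t))).
  by rewrite -expRD; congr (_ * expR _); ring.
by field; rewrite gt_eqF.
Qed.

Lemma coef_le k t : 0 <= t -> `|A k t| <= `|A0 k| / A0 ord0 * A ord0 t.
Proof.
move=> t0; rewrite coef_ratio ler_wpM2r ?(ltW (coef0_gt0 t))//.
rewrite ler_piMr ?divr_ge0 ?(ltW A0_gt0)// -[leRHS]expR0 ler_expR oppr_le0.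
by rewrite mulr_ge0// subr_ge0 M_le.
Qed.

(** The coefficients sum to 1 and none of them grows relatively to the leading
    one, which therefore cannot become small. *)
Lemma coef0_ge : exists2 c : R, 0 < c & forall t, 0 <= t -> c <= A ord0 t.
Proof.
pose U := \sum_k `|A0 k| / A0 ord0.
have U0 : 0 < U.
  rewrite /U (bigD1 ord0)//= ltr_wpDr ?sumr_ge0//.
    by move=> k _; rewrite divr_ge0// ltW.
  by rewrite divr_gt0// normr_gt0 gt_eqF.
exists U^-1; first by rewrite invr_gt0.
move=> t t0; rewrite -[U^-1]mul1r ler_pdivrMr// -[leLHS](coef_sum t0) /U
  mulr_sumr.
apply: ler_sum => k _; apply: (le_trans (ler_norm _)).
by rewrite [leRHS]mulrC; exact: coef_le.
Qed.

(** Tightness: a fixed unit interval carries a mass comparable with the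
    leading coefficient, uniformly in time. *)
Lemma solution_mass : exists X kap : R, [/\ 0 < X, 0 < kap &
  forall t (g : R -> R) (c b : R), 0 <= t -> measurable_fun Rpos g ->
    (forall x, 0 < x -> 0 <= g x <= b) -> 0 <= c ->
    (forall x, X <= x <= X + 1 -> c <= g x) ->
    A ord0 t * kap * c <= Rint (fun x => p t x * g x)].
Proof.
have [X X0 HX] := expsum_tail_ge lam_incr (fun k => `|A0 k| / A0 ord0) lam0_gt0.
exists X, (lam ord0 / 2 * expR (- (lam ord0 * (X + 1)))); split => //.
  by rewrite mulr_gt0 ?divr_gt0 ?expR_gt0.
move=> t g c b t0 mg gb c0 gc; have [lp p0 _] := p_density t0.
have [lI I1] := Rint_indic_unit X0.
set K := A ord0 t * _ * c.
have K0 : 0 <= K.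
  by rewrite !mulr_ge0 ?expR_ge0// ltW// lam_gt0.
rewrite -[K]mulr1 -I1 -RintZ//; apply: le_Rint_ae.
- exact: inL1Z.
- apply: (inL1_mul_bounded lp mg (c := b)) => x x0.
  by have /andP[g0 gxb] := gb x x0; rewrite ger0_norm.
apply: filterS2 p0 (pE t0) => x + + x0 => /(_ x0) px /(_ x0) pxE.
have /andP[gx _] := gb x x0.
rewrite indicE; case: (boolP (x \in _)) => [|_]; last by rewrite mulr0 mulr_ge0.
rewrite inE/= in_itv/= => /andP[Xx xX]; rewrite mulr1.
rewrite /K; apply: ler_pM => //; last by apply: gc; rewrite Xx.
  by rewrite !mulr_ge0 ?expR_ge0// ltW// lam_gt0.
rewrite pxE; apply: le_trans (HX _ (coef0_gt0 t) (fun k => coef_le k t0) x Xx).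
rewrite ler_pM2l ?coef0_gt0// ler_wpM2l ?divr_ge0 ?(ltW lam0_gt0)//.
by rewrite ler_expR lerN2 ler_pM2l.
Qed.

Lemma coef0_le : exists C : R, forall t, 0 <= t -> A ord0 t <= C.
Proof.
have [X [kap [X0 k0 H]]] := solution_mass.
exists kap^-1 => t t0; rewrite -[kap^-1]mul1r ler_pdivlMr//.
have [lp _ p1] := p_density t0.
have := H t (fun=> 1) 1 1 t0 (measurable_cst _); rewrite mulr1.
have -> : Rint (fun x => p t x * 1) = 1.
  by rewrite -[RHS]p1; apply: Rint_ext => x _; rewrite mulr1.
by apply => // x _; rewrite ler01 lexx.
Qed.

(** The derivative of [M ord0 - M k] is the integral of the density against a
    difference of exponentials; this weight is bounded below on the interval
    of [solution_mass], uniformly in [k] because [lam k >= lam (inord 1)]. *)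
Lemma M_gap : exists2 d : R, 0 < d &
  forall k t, k != ord0 -> 0 <= t -> d * t <= M ord0 t - M k t.
Proof.
have [X [kap [X0 kap0 H]]] := solution_mass.
have [c c0 Hc] := coef0_ge.
pose k1 : 'I_N.+1 := inord 1.
(* For N = 0 there is no other index than ord0, and inord 1 is ord0. *)
have [k10|k10] := eqVneq k1 ord0.
  by exists 1 => // k t /inord1_neq0; rewrite -/k1 k10 eqxx.
have gap := lam_gap lam_incr k10.
pose w := expR (- (lam ord0 * (X + 1))) * (1 - expR (- ((lam k1 - lam ord0) *
  X))).
have w0 : 0 < w.
  rewrite mulr_gt0 ?expR_gt0// subr_gt0 -[ltRHS]expR0 ltr_expR oppr_lt0.
  by rewrite mulr_gt0.
exists (c * kap * w); first by rewrite (mulr_gt0 (mulr_gt0 c0 kap0) w0).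
move=> k t k0 t0.
have wE (x : R) : expR (- (lam ord0 * x)) - expR (- (lam k1 * x)) =
    expR (- (lam ord0 * x)) * (1 - expR (- ((lam k1 - lam ord0) * x))).
  by rewrite mulrBr mulr1 -expRD; congr (_ - expR _); ring.
have key (s : R) : 0 <= s ->
    c * kap * w <= laplace (p s) (lam ord0) - laplace (p s) (lam k).
  move=> s0; have [lp p0 _] := p_density s0.
  apply: (@le_trans _ _ (laplace (p s) (lam ord0) - laplace (p s) (lam k1)));
    last first.
    by rewrite lerD2l lerN2; apply: laplace_le => //;
      [exact/ltW/lam_gt0|exact: lam_ge1].
  rewrite /laplace -RintB;
    [|exact/inL1_laplace/ltW/lam_gt0|exact/inL1_laplace/ltW/lam_gt0].
  rewrite (Rint_ext (g := fun x => p s x * (expR (- (lam ord0 * x)) - expR (-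
    (lam k1 * x))))); last first.
    by move=> x _; rewrite mulrBr.
  apply: le_trans (H s _ w 1 s0 _ _ (ltW w0) _).
  - by rewrite ler_wpM2r ?(ltW w0)// ler_wpM2r ?(ltW kap0)// Hc.
  - by apply: measurable_funB; exact: measurable_expRN.
  - move=> x x0; have E1 := expRN_norm_le1 (ltW lam0_gt0) x0.
    rewrite (ger0_norm (expR_ge0 _)) in E1.
    have E2 := expR_ge0 (- (lam k1 * x)).
    have : expR (- (lam k1 * x)) <= expR (- (lam ord0 * x)).
      by rewrite ler_expR lerN2 ler_wpM2r ?(ltW x0)//; lra.
    by move=> E3; apply/andP; split; lra.
  - move=> x /andP[Xx xX]; rewrite wE; apply: ler_pM.
    + exact: expR_ge0.
    + by rewrite subr_ge0 -[leRHS]expR0 ler_expR oppr_le0 mulr_ge0// ltW.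
    + by rewrite ler_expR lerN2 ler_pM2l.
    + by rewrite lerD2l lerN2 ler_expR lerN2 ler_pM2l.
have dD (s : R) : 0 <= s -> is_derive s 1 (fun s : R => M ord0 s - M k s - c *
  kap * w * s)
    (laplace (p s) (lam ord0) - laplace (p s) (lam k) - c * kap * w).
  move=> s0; have := dM ord0 s0; have := dM k s0 => ? ?; apply: is_derive_eq.
  by rewrite /GRing.scale /= mulr1 ?mulr0 ?addr0.
have := is_derive_ge0_le dD _ (lexx 0) t0.
rewrite !M0 mulr0 !subr0 subr_ge0; apply => s s0.
by rewrite subr_ge0 key.
Qed.

Lemma coef_decay : exists C d : R, 0 < d /\
  forall k t, k != ord0 -> 0 <= t -> `|A k t| <= C * expR (- (d * t)).
Proof.
have [d d0 Hd] := M_gap; have [C HC] := coef0_le.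
have C0 : 0 <= C by apply: le_trans (HC 0 (lexx 0)); exact/ltW/coef0_gt0.
pose U := \sum_k `|A0 k| / A0 ord0.
exists (U * C), (2 * d); split; first by rewrite mulr_gt0.
move=> k t k0 t0; rewrite coef_ratio mulrAC; apply: ler_pM.
- by rewrite mulr_ge0 ?divr_ge0// ltW// coef0_gt0.
- exact: expR_ge0.
- apply: ler_pM; rewrite ?HC ?divr_ge0 ?(ltW A0_gt0)//;
    first exact/ltW/coef0_gt0.
  rewrite /U (bigD1 k)//= lerDl sumr_ge0// => j _; rewrite divr_ge0// ltW//.
- by rewrite ler_expR lerN2 -mulrA ler_pM2l// Hd.
Qed.

Lemma coef_cvg0 k : k != ord0 -> A k t @[t --> +oo] --> (0 : R).
Proof.
move=> k0; have [C [d [d0 H]]] := coef_decay.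
apply/cvgr0Pnorm_le => e e0.
have HC : C * expR (- (d * t)) @[t --> +oo] --> C * 0.
  by apply: cvgM; [exact: cvg_cst|exact: cvg_expRN].
rewrite mulr0 in HC; have /= := cvgr_lt _ HC _ e0 => He.
near=> t; apply: (le_trans (H k t k0 _)).
  by near: t; apply: nbhs_pinfty_ge; rewrite num_real.
by apply/ltW; near: t; exact: He.
Unshelve. all: by end_near. Qed.

Lemma coef0_cvg1 : A ord0 t @[t --> +oo] --> (1 : R).
Proof.
have H : \sum_(k | k != ord0) A k t @[t --> +oo] --> (0 : R).
  have := @cvg_sumr _ _ (pinfty_nbhs R) _ _ (index_enum 'I_N.+1) (fun k => k !=
    ord0) A (fun=> 0).
  by rewrite big1//; apply => k; exact: coef_cvg0.
have H1 : 1 - \sum_(k | k != ord0) A k t @[t --> +oo] --> (1 - 0 : R).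
  by apply: cvgB => //; exact: cvg_cst.
rewrite subr0 in H1; apply: cvg_trans H1; apply: near_eq_cvg; near=> t.
have t0 : 0 <= t by near: t; apply: nbhs_pinfty_ge; rewrite num_real.
by rewrite -[X in X - _](coef_sum t0) (bigD1 ord0)//= addrK.
Unshelve. all: by end_near. Qed.

(** The exponent of [A k], corrected by its asymptotic slope, has an
    exponentially small derivative: expanding the Laplace transform over the
    exponentials, the contribution of the leading one cancels the slope. *)
Lemma exponent_cvg k : exists L : R,
  2 * M k t - t + (lam k - lam ord0) / (lam k + lam ord0) * t
    @[t --> +oo] --> L.
Proof.
have [C [d [d0 H]]] := coef_decay.
pose c j := 2 * (lam j / (lam j + lam k) - lam ord0 / (lam ord0 + lam k)).
pose f t := 2 * laplace (p t) (lam k) - 1 + (lam k - lam ord0) / (lam k + lam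
  ord0).
apply: (@is_derive_expRN_cvg _ _ f ((\sum_j `|c j|) * C) d d0).
  move=> t t0; have := dM k t0 => ?; apply: is_derive_eq.
  by rewrite /f /GRing.scale /=; ring.
move=> t t0; have -> : f t = \sum_j c j * A j t.
  have lp := solution_inL1 t0; have lk := lam_gt0 k.
  rewrite /f (laplace_ae lp (inL1_expsum _ lam_gt0) (ltW lk) (pE t0)).
  rewrite laplace_expsum//; [|exact: lam_gt0|exact: ltW].
  transitivity (2 * (\sum_j A j t * (lam j / (lam j + lam k))) -
      2 * (lam ord0 / (lam ord0 + lam k)) * \sum_j A j t).
    rewrite (coef_sum t0) mulr1; set S := \sum_j _.
    by field; rewrite gt_eqF// addr_gt0.
  rewrite !mulr_sumr -sumrB; apply: eq_bigr => j _; rewrite /c; ring.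
apply: (le_trans (ler_norm_sum _ _ _)); rewrite !mulr_suml;
  apply: ler_sum => j _.
rewrite normrM -mulrA; have [->|j0] := eqVneq j ord0.
  by rewrite /c subrr mulr0 normr0 !mul0r.
by rewrite ler_wpM2l// H.
Qed.

Lemma coef_asymptotics k : A0 k != 0 ->
  sim_pinfty (fun t => A k t)
    (fun t => expR (- ((lam k - lam ord0) / (lam k + lam ord0) * t))).
Proof.
move=> Ak; have [L HL] := exponent_cvg k.
exists (A0 k * expR L); first by rewrite mulf_neq0// gt_eqF// expR_gt0.
have -> : (fun t => A k t / expR (- ((lam k - lam ord0) / (lam k + lam ord0) *
  t))) =
    (fun t => A0 k * expR (2 * M k t - t + (lam k - lam ord0) / (lam k + lam
      ord0) * t)).
  by apply/funext => t; rewrite -expRN opprK -mulrA -expRD.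
apply: cvgM; first exact: cvg_cst.
by apply: continuous_cvg => //; exact: continuous_expR.
Qed.

Lemma expsum_coef_cvg x :
  expsum lam (fun k => A k t) x @[t --> +oo] -->
    lam ord0 * expR (- (lam ord0 * x)).
Proof.
pose l (j : 'I_N.+1) : R := (j == ord0)%:R * lam j * expR (- (lam j * x)).
have := @cvg_sumr _ _ (pinfty_nbhs R) _ _ (index_enum 'I_N.+1) predT
  (fun j t => A j t * lam j * expR (- (lam j * x))) l.
have -> : \sum_j l j = lam ord0 * expR (- (lam ord0 * x)).
  rewrite (bigD1 ord0)//= {1}/l eqxx mul1r big1 ?addr0// => j /negPf j0.
  by rewrite /l j0 !mul0r.
apply => j _; apply: cvgM; last exact: cvg_cst.
apply: cvgM; last exact: cvg_cst.
have [->|j0] := eqVneq j ord0; first exact: coef0_cvg1.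
exact: coef_cvg0.
Qed.

Lemma mul_solution_ae t : 0 <= t ->
  eqL1 (fun x => x * p t x) (fun x => x * expsum lam (fun k => A k t) x).
Proof. by move=> /pE; apply: filterS => x + x0 => /(_ x0) ->. Qed.

Lemma mul_solution_inL1 t : 0 <= t -> inL1 (fun x => x * p t x).
Proof.
move=> t0; apply: inL1_ae (mul_solution_ae t0) _ _.
  apply: measurable_funM; first by apply: measurable_funTS.
  exact: inL1_measurable (solution_inL1 t0).
exact: (mul_expsum_Rint _ lam_gt0).1.
Qed.

Lemma rate_lt (i j : 'I_N.+1) : (i < j)%N ->
  (lam i - lam ord0) / (lam i + lam ord0) < (lam j - lam ord0) / (lam j + lam
    ord0).
Proof.
move=> /lam_incr ij; have l0 := lam0_gt0; have li := lam_gt0 i;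
  have lj := lam_gt0 j.
rewrite ltr_pdivrMr ?addr_gt0// mulrAC ltr_pdivlMr ?addr_gt0//.
have := mulr_gt0 l0 (_ : 0 < lam j - lam i); rewrite subr_gt0 => /(_ ij); nra.
Qed.

(** The mean is the sum of the [A k t / lam k]; the rates increase with [k], so
    the deviation from [(lam ord0)^-1] is governed by the index 1. *)
Lemma mean_asymptotics : (1 <= N)%N -> (forall k, A0 k != 0) ->
  sim_pinfty (fun t => mean (p t) - (lam ord0)^-1)
    (fun t => expR (- ((lam (inord 1) - lam ord0) / (lam (inord 1) + lam ord0)
      * t))).
Proof.
move=> N1 A0neq; pose k1 : 'I_N.+1 := inord 1.
pose r (k : 'I_N.+1) := (lam k - lam ord0) / (lam k + lam ord0).
have k1E : k1 = 1%N :> nat by rewrite /k1 inordK.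
have k10 : k1 != ord0 by rewrite -val_eqE /= k1E.
have l0 := lam0_gt0.
have [c c0 Hc] := coef_asymptotics (A0neq k1); rewrite -/k1 -/(r k1) in Hc *.
have gap := lam_gap lam_incr k10.
exists (c * ((lam k1)^-1 - (lam ord0)^-1)).
  rewrite mulf_neq0// subr_eq0; apply/eqP => /invr_inj E.
  by move: gap; rewrite E subrr ltxx.
pose l (k : 'I_N.+1) : R := (k == k1)%:R * c * ((lam k)^-1 - (lam ord0)^-1).
have sl : \sum_j l j = c * ((lam k1)^-1 - (lam ord0)^-1).
  rewrite (bigD1 k1)//= {1}/l eqxx mul1r big1 ?addr0// => j /negPf j0.
  by rewrite /l j0 !mul0r.
have H : \sum_k A k t / expR (- (r k1 * t)) * ((lam k)^-1 - (lam ord0)^-1)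
    @[t --> +oo] --> c * ((lam k1)^-1 - (lam ord0)^-1).
  rewrite -sl; apply: (@cvg_sumr _ _ (pinfty_nbhs R) _ _ (index_enum 'I_N.+1)
    predT
    (fun k t => A k t / expR (- (r k1 * t)) * ((lam k)^-1 - (lam ord0)^-1))).
  move=> k _; have [->|k0] := eqVneq k ord0.
    rewrite /l subrr mulr0; under eq_fun do rewrite mulr0; exact: cvg_cst.
  apply: cvgM; last exact: cvg_cst.
  have [->|kk1] := eqVneq k k1; first by rewrite mul1r.
  have rk : 0 < r k - r k1.
    rewrite subr_gt0; apply: rate_lt; rewrite k1E ltn_neqAle lt0n -val_eqE /=
      in k0 kk1 *.
    by rewrite eq_sym -[X in _ == X]k1E kk1.
  have [ck _ Hk] := coef_asymptotics (A0neq k).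
  have E : (fun t => A k t / expR (- (r k1 * t))) =
      (fun t => A k t / expR (- (r k * t)) * expR (- ((r k - r k1) * t))).
    apply/funext => t; rewrite -!expRN -[RHS]mulrA -expRD.
    by congr (_ * expR _); ring.
  by rewrite E mul0r -(mulr0 ck); apply: cvgM => //; exact: cvg_expRN.
apply: cvg_trans H.
apply: near_eq_cvg; near=> t.
  have t0 : 0 <= t by near: t; apply: nbhs_pinfty_ge; rewrite num_real.
  have [lx mE] := mul_expsum_Rint (fun k => A k t) lam_gt0.
  have -> : mean (p t) = \sum_k A k t / lam k.
    by rewrite -mE; apply: Rint_ae (mul_solution_ae t0) => //;
      exact: mul_solution_inL1.
  have -> : \sum_k A k t / lam k - (lam ord0)^-1 =
      \sum_k A k t * ((lam k)^-1 - (lam ord0)^-1).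
    under [RHS]eq_bigr do rewrite mulrBr.
    by rewrite sumrB -[in RHS]mulr_suml coef_sum// mul1r.
  by rewrite mulr_suml; apply: eq_bigr => k _; rewrite mulrAC.
Unshelve. all: by end_near. Qed.

End Long_time.
(** * Return to the original time, and conclusion *)

Section Conclusion.
Context {R : realType}.
Implicit Types (f g : R -> R) (r t x : R).

Notation mu := (@lebesgue_measure R).

(** Where they differ they differ on a ball, and balls are not negligible. *)
Lemma eqL1_continuous f g : eqL1 f g ->
  (forall x, 0 < x -> continuous_at x f) ->
  (forall x, 0 < x -> continuous_at x g) ->
  forall x, 0 < x -> f x = g x.
Proof.
move=> [Z [mZ Z0 fgZ]] cf cg x x0; apply/eqP; rewrite -subr_eq0;
  apply/negP => /negP fgx.
have cfg : f y - g y @[y --> x] --> f x - g x by apply: cvgB;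
  [exact: cf|exact: cg].
have n0 : 0 < `|f x - g x| by rewrite normr_gt0.
have /cvgrPdist_lt/(_ _ n0)/nbhs_ballP[e /= e0 He] := cfg.
pose d := Num.min e x.
have d0 : 0 < d by rewrite lt_min e0.
have dZ : ball x d `<=` Z.
  move=> y xy; apply: fgZ => /= H; have ye : ball x e y.
    by apply: le_ball xy; rewrite ge_min lexx.
  have y0 : 0 < y.
    have : ball x x y by apply: le_ball xy; rewrite ge_min lexx orbT.
    by rewrite /ball/= ltr_norml => /andP[_]; lra.
  by have := He y ye; rewrite (H y0) subrr subr0 ltxx.
have : (mu (ball x d) <= 0)%E.
  by rewrite -Z0; apply: le_measure => //; rewrite inE//;
    exact: measurable_ball.
by rewrite lebesgue_measure_ball ?(ltW d0)// lee_fin leNgt pmulrn_lgt0 ?d0.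
Qed.

Lemma cvgy_ln1D : ln (1 + t) @[t --> +oo] --> (+oo : set_system R).
Proof.
apply/cvgryPge => B; near=> t.
have tB : expR B <= t by near: t; apply: nbhs_pinfty_ge; rewrite num_real.
have t0 : 0 < t by apply: lt_le_trans tB; exact: expR_gt0.
rewrite -[leLHS]expRK ler_ln ?posrE ?expR_gt0 ?addr_gt0//.
by apply: le_trans tB _; rewrite lerDr.
Unshelve. all: by end_near. Qed.

Lemma time_change_cvg r :
  expR (- (r * ln (1 + t))) / t `^ (- r) @[t --> +oo] --> (1 : R).
Proof.
have L : ln (1 + t^-1) @[t --> +oo] --> (0 : R).
  (* 0 <= ln (1 + 1/t) <= 1/t *)
  apply: (@squeeze_cvgr _ _ _ _ (fun=> 0) (fun t => t^-1)).
  - near=> t; have t0 : 0 < t by near: t; apply: nbhs_pinfty_gt;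
      rewrite num_real.
    have ti : 0 < t^-1 by rewrite invr_gt0.
    rewrite le_ln1Dx ?andbT; last by rewrite (lt_trans _ ti)// ltrN10.
    by rewrite ln_ge0// lerDl ltW.
  - exact: cvg_cst.
  - apply/gtr0_cvgV0; last exact: cvg_id.
    by apply: nbhs_pinfty_gt; rewrite num_real.
have H : expR (- r * ln (1 + t^-1)) @[t --> +oo] --> expR (- r * 0).
  apply: continuous_cvg; first exact: continuous_expR.
  by apply: cvgM => //; exact: cvg_cst.
rewrite mulr0 expR0 in H; apply: cvg_trans H; apply: near_eq_cvg; near=> t.
have t0 : 0 < t by near: t; apply: nbhs_pinfty_gt; rewrite num_real.
rewrite /powR gt_eqF// -expRN -expRD; congr expR.
have -> : 1 + t^-1 = (1 + t) / t by field; rewrite gt_eqF.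
by rewrite ln_div ?posrE ?addr_gt0//; ring.
Unshelve. all: by end_near. Qed.

End Conclusion.

Section Time.
Context {R : realType}.

Lemma continuous_expsum N (lam a : 'I_N.+1 -> R) : continuous (expsum lam a).
Proof.
move=> x.
apply: (@cvg_sumr _ _ (nbhs x) _ _ (index_enum 'I_N.+1) predT
  (fun j y => a j * lam j * expR (- (lam j * y)))) => j _.
by apply: cvgM; [exact: cvg_cst|exact: continuous_expRN].
Qed.

Lemma sim_pinfty_time_change (F : R -> R) (r : R) :
  sim_pinfty F (fun s => expR (- (r * s))) ->
  sim_pinfty (fun t => F (ln (1 + t))) (fun t => t `^ (- r)).
Proof.
move=> [c c0 Hc]; exists c => //.
have H1 : F (ln (1 + t)) / expR (- (r * ln (1 + t))) @[t --> +oo] --> c.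
  exact: (@cvg_comp _ _ _ (fun t => ln (1 + t)) (fun s => F s / expR (- (r *
    s)))
    _ (pinfty_nbhs R) _ (@cvgy_ln1D R) Hc).
have H2 := time_change_cvg r.
rewrite -[c]mulr1.
have -> : (fun t => F (ln (1 + t)) / t `^ (- r)) =
  (fun t => F (ln (1 + t)) / expR (- (r * ln (1 + t))) *
            (expR (- (r * ln (1 + t))) / t `^ (- r))).
  by apply/funext => t; rewrite mulrA divfK// gt_eqF// expR_gt0.
exact: cvgM H1 H2.
Qed.

End Time.
Theorem mainTheorem2 (R : realType) (N : nat) (lam A0 : 'I_N.+1 -> R)
    (p : R -> R -> R)
    (N_ge1 : (1 <= N)%N)
    (lam0_gt0 : 0 < lam ord0)
    (lam_incr : forall i j : 'I_N.+1, (i < j)%N -> lam i < lam j)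
    (A0_neq0 : forall j, A0 j != 0)
    (A0_sum : \sum_(j < N.+1) A0 j = 1)
    (A0_density : forall x : R, 0 < x -> 0 <= expsum lam A0 x)
    (p_sol : is_solution p)
    (p_init : eqL1 (p 0) (expsum lam A0)) :
  let rate k := (lam k - lam ord0) / (lam k + lam ord0) in
  let k1 : 'I_N.+1 := inord 1 in
  let E (tau : R) := mean (p tau) in
  (exists A : 'I_N.+1 -> R -> R,
    [/\ forall j, A j 0 = A0 j,
        forall tau : R, 0 <= tau ->
          eqL1 (p tau) (expsum lam (fun j => A j tau)) /\
          \sum_(j < N.+1) A j tau = 1,
        forall k (tau : R), 0 <= tau ->
          has_deriv (A k) tau
            (A k tau *
             \sum_(j < N.+1) A j tau * ((lam j - lam k) / (lam j + lam k))) &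
        forall k : 'I_N.+1, (1 <= k)%N ->
          sim_pinfty (A k) (fun tau => expR (- (rate k * tau)))]) /\
  [/\ forall q, continuous_version p q ->
        forall x : R, 0 < x ->
          q tau x @[tau --> +oo%R] --> lam ord0 * expR (- (lam ord0 * x)),
      forall tau : R, 0 <= tau -> inL1 (fun x => x * p tau x),
      sim_pinfty (fun tau => E tau - (lam ord0)^-1)
                 (fun tau => expR (- (rate k1 * tau))),
      sim_pinfty (fun t => expR (- (rate k1 * ln (1 + t))))
                 (fun t => t `^ (- rate k1)) &
      sim_pinfty (fun t => E (ln (1 + t)) - (lam ord0)^-1)
                 (fun t => t `^ (- rate k1))].
Proof.
move=> rate k1 E.
have A0_ge0 := leading_coef_ge0 lam_incr lam0_gt0 A0_density.
have A0_gt0 : 0 < A0 ord0 by rewrite lt_neqAle eq_sym A0_neq0.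
have lam0 := lam_gt0 lam0_gt0 lam_incr.
have [M [M0 dM pE]] := solution_expsum lam0 p_sol p_init.
have p_density := p_sol.1.
have rate_mean : sim_pinfty (fun tau => E tau - (lam ord0)^-1)
    (fun tau => expR (- (rate k1 * tau))).
  exact: (mean_asymptotics lam0_gt0 lam_incr A0_gt0 p_density M0 dM pE).
split.
  exists (fun k t => A0 k * expR (2 * M k t - t)); split.
  - by move=> j; rewrite M0 mulr0 subr0 expR0 mulr1.
  - move=> t t0; split; first exact: pE.
    exact: (coef_sum lam0_gt0 lam_incr p_density pE).
  - move=> k t t0; apply: is_derive_has_deriv.
    apply: (is_derive_eq (is_derive_mulexpR (A0 k) (dM k t t0))).
    have [lp _ _] := p_density t t0.
    rewrite (laplace_ae lp (inL1_expsum _ lam0) (ltW (lam0 k)) (pE t t0)).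
    rewrite laplace_expsum//; last exact: ltW.
    have S1 := coef_sum lam0_gt0 lam_incr p_density pE t0.
    congr (_ * _); rewrite -[X in _ - X]S1 mulr_sumr -sumrB.
    apply: eq_bigr => j _; field.
    by rewrite gt_eqF// addr_gt0.
  - move=> k _.
    exact: (coef_asymptotics lam0_gt0 lam_incr A0_gt0 p_density M0 dM pE).
split => //.
- move=> q qv x x0.
  have H := expsum_coef_cvg lam0_gt0 lam_incr A0_gt0 p_density M0 dM pE (x :=
    x).
  apply: cvg_trans H; apply: near_eq_cvg; near=> t.
  have t0 : 0 <= t by near: t; apply: nbhs_pinfty_ge; rewrite num_real.
  have [cq pq] := qv t t0.
  apply: (eqL1_continuous (eqL1_trans (eqL1_sym (pE t t0)) pq)) => // y _.
  exact: continuous_expsum.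
- move=> t t0; exact: (mul_solution_inL1 lam0_gt0 lam_incr p_density pE).
- exists 1; [exact: oner_neq0|exact: time_change_cvg].
- exact: (sim_pinfty_time_change rate_mean).
Unshelve. all: by end_near. Qed.
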